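(* Let $\rho$ be an antisymmetric Fox pairing of degree $n\in\mathbb{Z}$ in a cocommutative graded Hopf algebra $A$. Let $B$ be a commutative ungraded Hopf algebra, let $t\in B$ be a trace-like element, and let $\bullet=\bullet_t$. Let $\{-,-\}:A_B\times A_B\to A_B$ be the unique $n$-graded bracket such that $$\{x_b,y_c\}=(-1)^{|x''|\,|y'|_n}\,(c''\bullet b^{(2)})\;\rho(x',y')_{s_B(b^{(3)})\,b^{(1)}}\;x''_{b^{(4)}}\;y''_{c'}\qquad (x,y\in A,\ b,c\in B).$$ Then $$\{x_b,y_c\}=(-1)^{|x''|\,|y'|_n}\,(b'\bullet t^{(2)})\,(c''\bullet t^{(4)})\;\rho(x',y')_{s_B(t^{(1)})\,t^{(3)}}\;x''_{b''}\;y''_{c'}$$ for any $x,y\in A$ and $b,c\in B$. Furthermore, the bracket $\{-,-\}$ is $B$-equivariant with respect to the $B$-coaction on $A_B$ determined by $\Delta(x_b)=x_{b''}\otimes s_B(b')b'''$ for $x\in A$, $b\in B$.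
   Context: Conventions. $\mathbb{K}$ is a fixed commutative ring; all objects are over $\mathbb{K}$, and $\otimes=\otimes_{\mathbb{K}}$. ''Graded'' means $\mathbb{Z}$-graded; ''ungraded'' objects are concentrated in degree $0$. For homogeneous $x$, $|x|$ is its degree and $|x|_n=|x|+n$. The tensor product of graded algebras has multiplication $(x\otimes b)(y\otimes c)=(-1)^{|b||y|}xy\otimes bc$. A graded algebra is commutative if $xy=(-1)^{|x||y|}yx$. In a graded bialgebra $A$ the comultiplication $\Delta_A$ and counit $\varepsilon_A$ are graded algebra homomorphisms; a graded Hopf algebra has in addition a graded linear antipode $s_A$ with $s_A(x')x''=x's_A(x'')=\varepsilon_A(x)1_A$. Sweedler notation: $\Delta(x)=x'\otimes x''=x^{(1)}\otimes x^{(2)}$, with iterated comultiplications $x'\otimes x''\otimes x'''$, $x^{(1)}\otimes\cdots\otimes x^{(k)}$; components are homogeneous and, for $x$ homogeneous, their degrees sum to $|x|$. $A$ is cocommutative if $x'\otimes x''=(-1)^{|x'||x''|}x''\otimes x'$ (then $s_A^2=\mathrm{id}$). Representation algebra. $A_B$ is the graded algebra generated by symbols $x_b$ ($x\in A$, $b\in B$), with $|x_b|=|x|+|b|$ for homogeneous $x,b$, subject to: bilinearity of $x_b$ in $(x,b)$; $(xy)_b=x_{b'}y_{b''}$; $(1_A)_b=\varepsilon_B(b)1$; $x_{bc}=x'_bx''_c$; $x_{(1_B)}=\varepsilon_A(x)1$; and $x_by_c=(-1)^{|x_b||y_c|}y_cx_b$. For $B$ an ungraded commutative Hopf algebra there is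 a unique $B$-coaction $\Delta:A_B\to A_B\otimes B$ (graded algebra homomorphism making $A_B$ a right $B$-comodule) with $\Delta(x_b)=x_{b''}\otimes s_B(b')b'''$. Equivariance. For right $B$-comodules $M,N$ with coactions written $\Delta(m)=m^\ell\otimes m^r$, a bilinear map $q:M\times M\to N$ is $B$-equivariant if $q(m_1,m_2^\ell)\otimes m_2^r=q(m_1^\ell,m_2)^\ell\otimes q(m_1^\ell,m_2)^r\,s_B(m_1^r)$ in $N\otimes B$ for all $m_1,m_2\in M$. Fox pairings. A Fox pairing of degree $n$ in $A$ is a bilinear map $\rho:A\times A\to A$ with $\rho(A^p,A^q)\subset A^{p+q+n}$, $\rho(x,yz)=\rho(x,y)z+\varepsilon_A(y)\rho(x,z)$ and $\rho(xy,z)=\rho(x,z)\varepsilon_A(y)+x\rho(y,z)$. It is antisymmetric if $(-1)^{|x|_n|y|_n}s_A^{-1}\rho(s_A(y),s_A(x))=-\rho(x,y)$ for homogeneous $x,y$. Brackets. An $n$-graded bracket in a graded algebra $R$ is a bilinear map $\{-,-\}:R\times R\to R$ with $\{R^p,R^q\}\subset R^{p+q+n}$ and, for homogeneous $x,y,z$, $\{x,yz\}=\{x,y\}z+(-1)^{|x|_n|y|}y\{x,z\}$ and $\{xy,z\}=x\{y,z\}+(-1)^{|y||z|_n}\{x,z\}y$. Balanced biderivations and trace-like elements. Let $I=\mathrm{Ker}\,\varepsilon_B$. A bilinear form $\bullet:B\times B\to\mathbb{K}$ is a biderivation if $(bc)\bullet d=\varepsilon_B(b)\,c\bullet d+\varepsilon_B(c)\,b\bullet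 d$ and $b\bullet(cd)=\varepsilon_B(c)\,b\bullet d+\varepsilon_B(d)\,b\bullet c$; it is balanced if $(b\bullet c'')s_B(c')c'''=(c\bullet b'')s_B(b''')b'$ for all $b,c$. Let $\mathfrak g$ be the module of derivations $\mu:B\to\mathbb{K}$ (linear maps with $\mu(bc)=\varepsilon_B(b)\mu(c)+\varepsilon_B(c)\mu(b)$) and $p:B\to I/I^2$, $p(b)=b-\varepsilon_B(b)1_B\bmod I^2$. An element $t\in B$ is trace-like if $t'\otimes t''=t''\otimes t'$ and the linear map $\mathfrak g\to I/I^2$, $\mu\mapsto\mu(t')p(t'')$ is an isomorphism. For such $t$ let $\overline b\in\mathfrak g$ be the preimage of $p(b)$ and put $b\bullet_tc=\overline b(c)$; for commutative $B$ this is a balanced biderivation in $B$. For antisymmetric $\rho$ in cocommutative $A$ and a balanced biderivation $\bullet$ in commutative ungraded $B$, the bracket in the claim exists and is unique. *)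

(* Defs.v *)
From HB Require Import structures.
From mathcomp Require Import all_boot all_algebra.
From mathcomp Require Import boolp classical_sets functions.
From mathcomp Require Import monalg.

Set Implicit Arguments.
Unset Strict Implicit.
Unset Printing Implicit Defensive.

Import GRing.Theory.
Local Open Scope classical_set_scope.
Local Open Scope quotient_scope.
Local Open Scope ring_scope.

Lemma malgU_scale (T : choiceType) (R : comNzRingType) (c : R) (k : T) :
  << c *g k >> = c *: << k >> :> {malg R[T]}.
Proof.
by apply/malgP => k'; rewrite mcoeffZ !mcoeffU; case: eqP; rewrite ?mulr1 ?mulr0.
Qed.

Section QuotientModule.
Variables (K : comNzRingType) (V : lmodType K).

Definition lspan (S : set V) : {pred V} := fun x =>
  `[< exists2 s : seq (K * V), (forall w, w \in s -> S w.2)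
                             & x = \sum_(w <- s) w.1 *: w.2 >].

Lemma lspan_submod S : submod_closed (lspan S).
Proof.
split=> [|a x y /asboolP[s sS ->] /asboolP[r rS ->]]; apply/asboolP.
  by exists [::] => //; rewrite big_nil.
exists ([seq (a * w.1, w.2) | w <- s] ++ r) => [w|].
  by rewrite mem_cat => /orP[/mapP[v /sS ? ->]|/rS].
rewrite big_cat big_map scaler_sumr; congr (_ + _).
by apply: eq_bigr => w _; rewrite scalerA.
Qed.
HB.instance Definition _ S := GRing.isSubmodClosed.Build K V (lspan S) (lspan_submod S).

Variable S : set V.
(* V modulo the submodule spanned by S *)
Definition quotmod := Quotient.quot (lspan S).
HB.instance Definition _ := GRing.Zmodule.on quotmod.
Definition qpi : V -> quotmod := \pi_(Quotient.quot (lspan S)).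

Lemma qpiD x y : qpi (x + y) = qpi x + qpi y.
Proof. by rewrite /qpi piE. Qed.

Lemma qpiP x y : qpi x = qpi y <-> x - y \in lspan S.
Proof. by rewrite Quotient.idealrBE; split=> /eqP. Qed.

Lemma qpi_surj u : exists x, u = qpi x.
Proof. by exists (repr u); rewrite /qpi reprK. Qed.

Definition qscale (a : K) (u : quotmod) : quotmod := qpi (a *: repr u).

Lemma qpiZ a x : qscale a (qpi x) = qpi (a *: x).
Proof.
by apply/qpiP; rewrite -scalerBr rpredZ //; apply/qpiP; rewrite /qpi reprK.
Qed.

Lemma qscaleA a b u : qscale a (qscale b u) = qscale (a * b) u.
Proof. by have [x ->] := qpi_surj u; rewrite !qpiZ scalerA. Qed.
Lemma qscale1 : left_id 1 qscale.
Proof. by move=> u; have [x ->] := qpi_surj u; rewrite qpiZ scale1r. Qed.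
Lemma qscaleDr : right_distributive qscale +%R.
Proof.
move=> a u v; have [x ->] := qpi_surj u; have [y ->] := qpi_surj v.
by rewrite -qpiD !qpiZ -qpiD scalerDr.
Qed.
Lemma qscaleDl u : {morph qscale^~ u : a b / a + b}.
Proof. by move=> a b; have [x ->] := qpi_surj u; rewrite !qpiZ -qpiD scalerDl. Qed.
HB.instance Definition _ := GRing.Zmodule_isLmodule.Build K quotmod
  qscaleA qscale1 qscaleDr qscaleDl.

Lemma qpi_linear : linear qpi.
Proof. by move=> a x y; rewrite qpiD -qpiZ. Qed.
HB.instance Definition _ := GRing.isLinear.Build K V quotmod *:%R qpi qpi_linear.
End QuotientModule.

Section Tensor.
Variables (K : comNzRingType) (M N : lmodType K).

Definition tgen (m : M) (n : N) : {malg K[(M * N)%type]} := << (m, n) >>.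

Variant tensor_rel : set {malg K[(M * N)%type]} :=
| TensorRelL a m m' n : tensor_rel (tgen (a *: m + m') n - a *: tgen m n - tgen m' n)
| TensorRelR a m n n' : tensor_rel (tgen m (a *: n + n') - a *: tgen m n - tgen m n').

Definition tensor := quotmod tensor_rel.
HB.instance Definition _ := GRing.Lmodule.on tensor.
Definition tens (m : M) (n : N) : tensor := qpi tensor_rel (tgen m n).
End Tensor.

Lemma tens_linl (K : comNzRingType) (M N : lmodType K) (n : N) :
  linear ((@tens K M N)^~ n).
Proof.
move=> a m m'; rewrite /tens -qpi_linear; apply/qpiP.
rewrite opprD addrA; apply/asboolP.
exists [:: (1, tgen (a *: m + m') n - a *: tgen m n - tgen m' n)].
  by move=> w; rewrite inE => /eqP ->; left.
by rewrite big_seq1 scale1r.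
Qed.

Lemma tens_linr (K : comNzRingType) (M N : lmodType K) (m : M) :
  linear (@tens K M N m).
Proof.
move=> a n n'; rewrite /tens -qpi_linear; apply/qpiP.
rewrite opprD addrA; apply/asboolP.
exists [:: (1, tgen m (a *: n + n') - a *: tgen m n - tgen m n')].
  by move=> w; rewrite inE => /eqP ->; right.
by rewrite big_seq1 scale1r.
Qed.

HB.instance Definition _ (K : comNzRingType) (M N : lmodType K) (m : M) :=
  GRing.isLinear.Build K N (tensor M N) *:%R (tens m) (tens_linr m).

Definition tensl (K : comNzRingType) (M N : lmodType K) (n : N) : M -> tensor M N :=
  (@tens K M N)^~ n.
HB.instance Definition _ (K : comNzRingType) (M N : lmodType K) (n : N) :=
  GRing.isLinear.Build K M (tensor M N) *:%R (tensl n) (tens_linl n).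

Lemma tensor_span (K : comNzRingType) (M N : lmodType K) (u : tensor M N) :
  exists s : seq (M * N), u = \sum_(w <- s) tens w.1 w.2.
Proof.
have [f ->] := qpi_surj u; rewrite (monalgE f) raddf_sum /=.
exists [seq (f@_k *: k.1, k.2) | k <- finmap.enum_fset (msupp f)]; rewrite big_map.
apply: eq_bigr => -[m n] _ /=.
rewrite malgU_scale -/(tgen m n).
by rewrite -[RHS]/(tensl n _) !linearZ.
Qed.

(* A family of submodules M^p (p : int) whose sum is M. *)
HB.mixin Record hasDegrees (K : comNzRingType) M of GRing.Lmodule K M := {
  hpart : int -> set M;
  hpart0 : forall p, hpart p 0;
  hpart_lin : forall p a x y, hpart p x -> hpart p y -> hpart p (a *: x + y);
  hpart_span : forall x, exists2 s : seq M,
    (forall y, y \in s -> exists p, hpart p y) & x = \sum_(y <- s) y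
}.
#[short(type="degModType")]
HB.structure Definition DegModule (K : comNzRingType) :=
  {M of hasDegrees K M & GRing.Lmodule K M}.

HB.mixin Record isGraded (K : comNzRingType) M of DegModule K M := {
  hpart_direct : forall (s : seq int) (f : int -> M), uniq s ->
    (forall p, hpart p (f p)) -> \sum_(p <- s) f p = 0 ->
    forall p, p \in s -> f p = 0
}.
#[short(type="gradedModType")]
HB.structure Definition GradedModule (K : comNzRingType) :=
  {M of isGraded K M & DegModule K M}.

HB.mixin Record isDegMultiplicative (K : comNzRingType) A
    of GRing.Algebra K A & hasDegrees K A := {
  hpart_one : hpart 0 (1 : A);
  hpart_mul : forall p q (x y : A), hpart p x -> hpart q y -> hpart (p + q) (x * y)
}.
#[short(type="degAlgType")]
HB.structure Definition DegAlgebra (K : comNzRingType) :=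
  {A of GRing.Algebra K A & hasDegrees K A & isDegMultiplicative K A}.
#[short(type="gradedAlgType")]
HB.structure Definition GradedAlgebra (K : comNzRingType) :=
  {A of DegAlgebra K A & isGraded K A}.

(* (-1)^z for z : int, through |z| since K has no inverses. *)
Definition ksgn (K : comNzRingType) (z : int) : K := (-1) ^+ `|z|%N.
Arguments ksgn {K} z.

Section Degrees.
Variables (K : comNzRingType) (M : degModType K).

(* The degree |x| of a homogeneous x; only the value at x != 0 matters. *)
Definition deg (x : M) : int := xget 0 [set p | hpart p x].

Definition homogeneous (x : M) : Prop := exists p, hpart p x.
End Degrees.

Section TensorDegrees.
Variables (K : comNzRingType) (M N : degModType K).

Definition tensor_hpart (n : int) : set (tensor M N) := [set u |
  exists2 s : seq (M * N),
    (forall w, w \in s -> exists p q, [/\ hpart p w.1, hpart q w.2 & p + q = n])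
    & u = \sum_(w <- s) tens w.1 w.2].

Definition hrep (u : tensor M N) : seq (M * N) := xget [::] [set s |
  (forall w, w \in s -> homogeneous w.1 /\ homogeneous w.2)
  /\ u = \sum_(w <- s) tens w.1 w.2].

(* Sweedler notation: if u = \sum_i m_i (x) n_i with m_i, n_i homogeneous, then
   [tsum u F] is \sum_i F m_i n_i. It is only used for F such that
   F restricts to a bilinear map on M^p * N^q for all p and q (signs depending on
   the degrees of m_i and n_i are allowed); then the choice of the
   decomposition of u is irrelevant. *)
Definition tsum (P : nmodType) (u : tensor M N) (F : M -> N -> P) : P :=
  \sum_(w <- hrep u) F w.1 w.2.

Lemma hrepP (u : tensor M N) :
  (forall w, w \in hrep u -> homogeneous w.1 /\ homogeneous w.2)
  /\ u = tsum u (@tens K M N).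
Proof.
suff: exists s : seq (M * N),
  (forall w, w \in s -> homogeneous w.1 /\ homogeneous w.2)
  /\ u = \sum_(w <- s) tens w.1 w.2 by move=> /(xgetPex [::]).
have [s ->] := tensor_span u.
elim: s => [|[m n] s [r [rh er]]]; first by exists [::]; split => //; rewrite !big_nil.
have [sm smh em] := hpart_span m; have [sn snh en] := hpart_span n.
exists ([seq (x, y) | x <- sm, y <- sn] ++ r); split=> [w|].
  by rewrite mem_cat => /orP[/allpairsP[z [/smh ? /snh ? ->]]|/rh].
rewrite big_cons big_cat er; congr (_ + _).
rewrite big_allpairs_dep /= -/(tensl _ _) em linear_sum; apply: eq_bigr => y _.
rewrite /tensl en; exact: linear_sum.
Qed.
End TensorDegrees.

Section TensorHom.
Variables (K : comNzRingType) (A1 A2 : degAlgType K).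

(* (x (x) b)(y (x) c) = (-1)^(|b||y|) xy (x) bc *)
Definition tensor_mul (u v : tensor A1 A2) : tensor A1 A2 :=
  tsum u (fun x b => tsum v (fun y c =>
    ksgn (deg b * deg y) *: tens (x * y) (b * c))).

Definition graded_alg_hom (A : degAlgType K) (f : A -> tensor A1 A2) : Prop :=
  [/\ linear f,
      (forall p x, hpart p x -> tensor_hpart p (f x)),
      f 1 = tens 1 1
    & forall x y, f (x * y) = tensor_mul (f x) (f y)].
End TensorHom.

HB.mixin Record isBialgebra (K : comNzRingType) A of GradedAlgebra K A := {
  comul : A -> tensor A A;
  counit : A -> K;
  comul_hom : graded_alg_hom comul;
  counit_linear : scalar counit;
  counit_hpart : forall p (x : A), hpart p x -> p != 0 -> counit x = 0;
  counit1 : counit 1 = 1;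
  counitM : forall x y : A, counit (x * y) = counit x * counit y;
  comulA : forall x : A,
    tsum (comul x) (fun x1 x2 => tsum (comul x1) (fun y1 y2 => tens y1 (tens y2 x2)))
    = tsum (comul x) (fun x1 x2 => tens x1 (comul x2));
  counitl : forall x : A, tsum (comul x) (fun x1 x2 => counit x1 *: x2) = x;
  counitr : forall x : A, tsum (comul x) (fun x1 x2 => counit x2 *: x1) = x
}.
#[short(type="gradedBialgType")]
HB.structure Definition GradedBialgebra (K : comNzRingType) :=
  {A of isBialgebra K A & GradedAlgebra K A}.

HB.mixin Record hasAntipode (K : comNzRingType) A of GradedBialgebra K A := {
  antipode : A -> A;
  antipode_linear : linear antipode;
  antipode_hpart : forall p (x : A), hpart p x -> hpart p (antipode x);
  antipodel : forall x : A,
    tsum (comul x) (fun x1 x2 => antipode x1 * x2) = counit x *: 1;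
  antipoder : forall x : A,
    tsum (comul x) (fun x1 x2 => x1 * antipode x2) = counit x *: 1
}.
#[short(type="gradedHopfType")]
HB.structure Definition GradedHopf (K : comNzRingType) :=
  {A of hasAntipode K A & GradedBialgebra K A}.

(* [sw2 x F], [sw3 x F] and [sw4 x F] are F x' x'', F x' x'' x''' and
   F x^(1) x^(2) x^(3) x^(4) in Sweedler notation. *)
Section Sweedler.
Variables (K : comNzRingType) (A : gradedBialgType K) (P : nmodType).
Definition sw2 (x : A) (F : A -> A -> P) : P := tsum (comul x) F.
Definition sw3 (x : A) (F : A -> A -> A -> P) : P :=
  sw2 x (fun x1 x2 => sw2 x2 (F x1)).
Definition sw4 (x : A) (F : A -> A -> A -> A -> P) : P :=
  sw2 x (fun x1 x2 => sw3 x2 (F x1)).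
End Sweedler.

Definition ungraded (K : comNzRingType) (M : degModType K) : Prop :=
  forall x : M, hpart 0 x.

Definition graded_commutative (K : comNzRingType) (A : degAlgType K) : Prop :=
  forall p q (x y : A), hpart p x -> hpart q y -> x * y = ksgn (p * q) *: (y * x).

Definition cocommutative (K : comNzRingType) (A : gradedBialgType K) : Prop :=
  forall x : A, comul x = sw2 x (fun x1 x2 => ksgn (deg x1 * deg x2) *: tens x2 x1).

Definition bilinear_map (K : comNzRingType) (M N P : lmodType K) (f : M -> N -> P) : Prop :=
  (forall x, linear (f x)) /\ (forall y, linear (f^~ y)).

Definition fox_pairing (K : comNzRingType) (A : gradedHopfType K) (n : int)
    (rho : A -> A -> A) : Prop :=
  [/\ bilinear_map rho,
      (forall p q x y, hpart p x -> hpart q y -> hpart (p + q + n) (rho x y)),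
      (forall x y z, rho x (y * z) = rho x y * z + counit y *: rho x z)
    & (forall x y z, rho (x * y) z = counit y *: rho x z + x * rho y z)].

Definition antipode_inv (K : comNzRingType) (A : gradedHopfType K) (y : A) : A :=
  xget 0 [set x | antipode x = y].

Definition fox_antisymmetric (K : comNzRingType) (A : gradedHopfType K) (n : int)
    (rho : A -> A -> A) : Prop :=
  forall p q x y, hpart p x -> hpart q y ->
    ksgn ((p + n) * (q + n)) *: antipode_inv (rho (antipode y) (antipode x)) = - rho x y.

Definition graded_bracket (K : comNzRingType) (R : degAlgType K) (n : int)
    (br : R -> R -> R) : Prop :=
  [/\ bilinear_map br,
      (forall p q x y, hpart p x -> hpart q y -> hpart (p + q + n) (br x y)),
      (forall p q x y z, hpart p x -> hpart q y ->
         br x (y * z) = br x y * z + ksgn ((p + n) * q) *: (y * br x z))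
    & (forall q r x y z, hpart q y -> hpart r z ->
         br (x * y) z = x * br y z + ksgn (q * (r + n)) *: (br x z * y))].

HB.instance Definition _ (K : comNzRingType) (A : gradedBialgType K) :=
  GRing.isLinear.Build K A K *%R counit counit_linear.

Section TraceLike.
Variables (K : comNzRingType) (B : gradedHopfType K).

Definition augid_pred : {pred B} := fun b => counit b == 0.

Lemma augid_submod : submod_closed augid_pred.
Proof.
rewrite /augid_pred; split=> [|a x y] /=; rewrite -!topredE /=.
  by have := counit_linear (-1) (0 : B) 0; rewrite scaler0 addr0 mulN1r addNr => ->.
by rewrite counit_linear => /eqP -> /eqP ->; rewrite mulr0 addr0.
Qed.
HB.instance Definition _ := GRing.isSubmodClosed.Build K B augid_pred augid_submod.

Record augid := AugId { augid_val : B; _ : augid_val \in augid_pred }.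
HB.instance Definition _ := [isSub for augid_val].
HB.instance Definition _ := [Choice of augid by <:].
HB.instance Definition _ := [SubChoice_isSubLmodule of augid by <:].

Lemma augid_part_proof (b : B) : b - counit b *: 1 \in augid_pred.
Proof.
rewrite unfold_in /augid_pred -scaleNr addrC counit_linear.
by rewrite counit1 mulr1 addNr.
Qed.

Variant aug_product : set augid :=
| AugProduct (x y z : augid) of val z = val x * val y : aug_product z.

(* I / I^2 for I = Ker counit *)
Definition cotangent := quotmod aug_product.
HB.instance Definition _ := GRing.Lmodule.on cotangent.

Definition cotangent_class (b : B) : cotangent :=
  qpi aug_product (AugId (augid_part_proof b)).

Definition derivations : set (B -> K) := [set mu |
  scalar mu /\ forall b c, mu (b * c) = counit b * mu c + counit c * mu b].

Definition trace_map (t : B) (mu : B -> K) : cotangent :=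
  sw2 t (fun t1 t2 => mu t1 *: cotangent_class t2).

Definition trace_like (t : B) : Prop :=
  comul t = sw2 t (fun t1 t2 => tens t2 t1)
  /\ set_bij derivations [set: cotangent] (trace_map t).

(* b \bullet_t c = (overline b)(c), where overline b is the unique derivation
   with the class of b as image under [trace_map t] when t is trace-like. *)
Definition trace_form (t b c : B) : K :=
  xget (fun=> 0) [set mu | derivations mu /\ trace_map t mu = cotangent_class b] c.
End TraceLike.

Section Comodule.
Variables (K : comNzRingType) (B : gradedHopfType K).

Definition comodule (M : degModType K) (coact : M -> tensor M B) : Prop :=
  [/\ linear coact,
      (forall m, tsum (coact m) (fun l r => tsum (coact l) (fun l' r' => tens l' (tens r' r)))
               = tsum (coact m) (fun l r => tens l (comul r)))
    & (forall m, tsum (coact m) (fun l r => counit r *: l) = m)].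

Definition equivariant (M N : degModType K) (coactM : M -> tensor M B)
    (coactN : N -> tensor N B) (q : M -> M -> N) : Prop :=
  forall m1 m2,
    tsum (coactM m2) (fun l r => tens (q m1 l) r)
    = tsum (coactM m1) (fun l r =>
        tsum (coactN (q l m2)) (fun l' r' => tens l' (r' * antipode r))).
End Comodule.

Section RepresentationAlgebra.
Variables (K : comNzRingType) (A B : gradedBialgType K).

Definition freealg := {malg K[{fmonom (A * B)%type}]}.
HB.instance Definition _ := GRing.Lalgebra.on freealg.

Definition fsym (x : A) (b : B) : freealg := << fmu (x, b) >>.

Variant rep_rel : set freealg :=
| RepLinL a x y b : rep_rel (fsym (a *: x + y) b - a *: fsym x b - fsym y b)
| RepLinR a x b c : rep_rel (fsym x (a *: b + c) - a *: fsym x b - fsym x c)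
| RepMul x y b : rep_rel (fsym (x * y) b - sw2 b (fun b1 b2 => fsym x b1 * fsym y b2))
| RepOne b : rep_rel (fsym 1 b - counit b *: 1)
| RepComul x b c : rep_rel (fsym x (b * c) - sw2 x (fun x1 x2 => fsym x1 b * fsym x2 c))
| RepCounit x : rep_rel (fsym x 1 - counit x *: 1)
| RepComm p q r s x b y c of hpart p x & hpart q b & hpart r y & hpart s c :
    rep_rel (fsym x b * fsym y c - ksgn ((p + q) * (r + s)) *: (fsym y c * fsym x b)).

(* the two-sided ideal generated by rep_rel is the span of rep_ideal_gen *)
Variant rep_ideal_gen : set freealg :=
| RepIdealGen f r g of rep_rel r : rep_ideal_gen (f * r * g).

Definition repalg := quotmod rep_ideal_gen.
HB.instance Definition _ := GRing.Lmodule.on repalg.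

Local Notation rpi := (qpi rep_ideal_gen : freealg -> repalg).

Lemma freealg_scalerAr (a : K) (f g : freealg) : a *: (f * g) = f * (a *: g).
Proof.
have ac (h : freealg) : h * a%:MP = a *: h.
  rewrite -mul_malgC !malgM_def fgmulgU fgmulUg; apply: eq_bigr => k _.
  by rewrite mulrC mul1m mulm1.
by rewrite -!ac mulrA.
Qed.

Lemma rep_ideal_mul (f g h : freealg) :
  g \in lspan rep_ideal_gen -> f * g * h \in lspan rep_ideal_gen.
Proof.
move=> /asboolP[s sS ->]; apply/asboolP.
exists [seq (w.1, f * w.2 * h) | w <- s] => [w|].
  move=> /mapP[v /sS vS ->] /=; case: vS => f' r g' rr.
  by rewrite !mulrA -mulrA; constructor.
rewrite big_map mulr_sumr mulr_suml; apply: eq_bigr => w _ /=.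
by rewrite -freealg_scalerAr -scalerAl.
Qed.

Definition repalg_mul (u v : repalg) : repalg := rpi (repr u * repr v).

Lemma rpiM (f g : freealg) : repalg_mul (rpi f) (rpi g) = rpi (f * g).
Proof.
have reprE (k : freealg) : repr (rpi k) - k \in lspan rep_ideal_gen.
  by apply/qpiP; rewrite /qpi reprK.
apply/qpiP; set f' := repr _; set g' := repr _.
have -> : f' * g' - f * g = 1 * (f' - f) * g' + f * (g' - g) * 1.
  by rewrite mul1r mulr1 mulrBl mulrBr addrA subrK.
by apply: rpredD; apply: rep_ideal_mul; apply: reprE.
Qed.

Lemma repalg_mulA : associative repalg_mul.
Proof.
move=> u v w; have [f ->] := qpi_surj u; have [g ->] := qpi_surj v.
by have [h ->] := qpi_surj w; rewrite !rpiM mulrA.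
Qed.
Lemma repalg_mul1 : left_id (rpi 1) repalg_mul.
Proof. by move=> u; have [f ->] := qpi_surj u; rewrite rpiM mul1r. Qed.
Lemma repalg_mulr1 : right_id (rpi 1) repalg_mul.
Proof. by move=> u; have [f ->] := qpi_surj u; rewrite rpiM mulr1. Qed.
Lemma repalg_mulDl : left_distributive repalg_mul +%R.
Proof.
move=> u v w; have [f ->] := qpi_surj u; have [g ->] := qpi_surj v.
by have [h ->] := qpi_surj w; rewrite -qpiD !rpiM -qpiD mulrDl.
Qed.
Lemma repalg_mulDr : right_distributive repalg_mul +%R.
Proof.
move=> u v w; have [f ->] := qpi_surj u; have [g ->] := qpi_surj v.
by have [h ->] := qpi_surj w; rewrite -qpiD !rpiM -qpiD mulrDr.
Qed.

(* x_b |-> counit x * counit b induces an augmentation of the representation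
   algebra, whence 1 != 0. *)
Definition fmon_counit (w : {fmonom (A * B)%type}) : K :=
  \prod_(u <- fmonom_val w) (counit u.1 * counit u.2).

Lemma fmon_counit_morph : mmorphism fmon_counit.
Proof.
split=> [v w|]; rewrite /fmon_counit; last by rewrite fm1 big_nil.
by rewrite fmM big_cat.
Qed.
HB.instance Definition _ := isMultiplicative.Build _ _ fmon_counit fmon_counit_morph.

Definition freealg_counit : freealg -> K := mmap idfun fmon_counit.
HB.instance Definition _ := GRing.RMorphism.on freealg_counit.

Lemma freealg_counitZ a f : freealg_counit (a *: f) = a * freealg_counit f.
Proof. exact: mmapZ. Qed.

Lemma freealg_counitM f g : freealg_counit (f * g) = freealg_counit f * freealg_counit g.
Proof. exact: rmorphM. Qed.

Lemma freealg_counitB f g : freealg_counit (f - g) = freealg_counit f - freealg_counit g.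
Proof. exact: rmorphB. Qed.

Lemma freealg_counit_sym x b : freealg_counit (fsym x b) = counit x * counit b.
Proof. by rewrite /freealg_counit mmapU mul1r /fmon_counit fmU big_seq1. Qed.

Lemma counit_sw2 (C : gradedBialgType K) (x : C) :
  sw2 x (fun x1 x2 => counit x1 * counit x2) = counit x.
Proof.
rewrite -[in RHS](counitl x) /sw2 /tsum.
rewrite linear_sum; apply: eq_bigr => w _.
by rewrite linearZ.
Qed.

Lemma freealg_counit_rel r : rep_rel r -> freealg_counit r = 0.
Proof.
have sgn0 p q (C D : gradedBialgType K) (x : C) (b : D) (d : int) :
  hpart p x -> hpart q b -> ksgn ((p + q) * d) * (counit x * counit b)
    = counit x * counit b.
  move=> xp bq; have [p0|/(counit_hpart _ _ xp) ->] := eqVneq p 0; last first.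
    by rewrite mul0r mulr0.
  have [q0|/(counit_hpart _ _ bq) ->] := eqVneq q 0; last by rewrite !mulr0.
  by rewrite p0 q0 mul0r mul1r.
case=> [a x y b|a x b c|x y b|b|x b c|x|p q r' s x b y c xp bq yr cs].
- rewrite !freealg_counitB freealg_counitZ !freealg_counit_sym counit_linear.
  by rewrite mulrDl mulrA addrAC addrK subrr.
- rewrite !freealg_counitB freealg_counitZ !freealg_counit_sym counit_linear.
  by rewrite mulrDr mulrCA addrAC addrK subrr.
- rewrite rmorphB /= freealg_counit_sym counitM -(counit_sw2 b).
  rewrite /sw2 /tsum rmorph_sum mulr_sumr; apply/eqP; rewrite subr_eq0; apply/eqP.
  apply: eq_bigr => w _; rewrite rmorphM /= !freealg_counit_sym.
  by rewrite -!mulrA; congr (_ * _); rewrite mulrCA.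
- by rewrite rmorphB /= freealg_counit_sym freealg_counitZ rmorph1 counit1 mul1r mulr1 subrr.
- rewrite rmorphB /= freealg_counit_sym counitM -(counit_sw2 x).
  rewrite /sw2 /tsum rmorph_sum mulr_suml; apply/eqP; rewrite subr_eq0; apply/eqP.
  apply: eq_bigr => w _; rewrite rmorphM /= !freealg_counit_sym.
  by rewrite mulrACA.
- by rewrite rmorphB /= freealg_counit_sym freealg_counitZ rmorph1 counit1 subrr.
- have cE u v w z : freealg_counit (fsym u v * fsym w z)
      = counit u * counit v * (counit w * counit z).
    by rewrite freealg_counitM; congr (_ * _); apply: freealg_counit_sym.
  rewrite freealg_counitB cE freealg_counitZ cE (mulrC (counit y * _)).
  by rewrite [ksgn _ * _]mulrA (sgn0 _ _ _ _ _ _ _ xp bq) subrr.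
Qed.

Lemma repalg_one_neq0 : rpi 1 != 0.
Proof.
apply/eqP => e; suff: freealg_counit 1 = 0 by rewrite rmorph1 => /eqP; rewrite oner_eq0.
have /qpiP : rpi 1 = rpi 0 by rewrite e raddf0.
rewrite subr0 => /asboolP[s sS ->]; rewrite rmorph_sum big1_seq // => w /andP[_ /sS].
case: w => a _ /= [f r g /freealg_counit_rel er].
by rewrite freealg_counitZ !freealg_counitM er mulr0 mul0r mulr0.
Qed.

HB.instance Definition _ := GRing.Zmodule_isNzRing.Build repalg
  repalg_mulA repalg_mul1 repalg_mulr1 repalg_mulDl repalg_mulDr repalg_one_neq0.

Lemma rpi_mul (f g : freealg) : rpi f * rpi g = rpi (f * g).
Proof. exact: rpiM. Qed.

Lemma repalg_scalerAl (a : K) (u v : repalg) : a *: (u * v) = a *: u * v.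
Proof.
have aE h : a *: rpi h = rpi (a *: h) by rewrite linearZ.
have [f ->] := qpi_surj u; have [g ->] := qpi_surj v.
by rewrite rpi_mul !aE rpi_mul -scalerAl.
Qed.
HB.instance Definition _ := GRing.Lmodule_isLalgebra.Build K repalg repalg_scalerAl.

Lemma repalg_scalerAr (a : K) (u v : repalg) : a *: (u * v) = u * (a *: v).
Proof.
have aE h : a *: rpi h = rpi (a *: h) by rewrite linearZ.
have [f ->] := qpi_surj u; have [g ->] := qpi_surj v.
by rewrite rpi_mul !aE rpi_mul freealg_scalerAr.
Qed.
HB.instance Definition _ := GRing.Lalgebra_isAlgebra.Build K repalg repalg_scalerAr.

(* [rep x b] is x_b *)
Definition rep (x : A) (b : B) : repalg := rpi (fsym x b).

Lemma rep_relP r : rep_rel r -> rpi r = 0.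
Proof.
move=> rr; rewrite -(raddf0 rpi); apply/qpiP; rewrite subr0; apply/asboolP.
exists [:: (1, 1 * r * 1)] => [w|]; first by rewrite inE => /eqP ->.
by rewrite big_seq1 scale1r mul1r mulr1.
Qed.

Lemma rep_linl b : linear (rep^~ b).
Proof.
move=> a x y; apply/eqP; rewrite /rep -subr_eq0 opprD addrA; apply/eqP.
by have := rep_relP (RepLinL a x y b); rewrite !raddfB /= linearZ.
Qed.

Lemma rep_linr x : linear (rep x).
Proof.
move=> a b c; apply/eqP; rewrite /rep -subr_eq0 opprD addrA; apply/eqP.
by have := rep_relP (RepLinR a x b c); rewrite !raddfB /= linearZ.
Qed.
HB.instance Definition _ x := GRing.isLinear.Build K B repalg *:%R (rep x) (rep_linr x).
Definition repl (b : B) : A -> repalg := rep^~ b.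
HB.instance Definition _ b := GRing.isLinear.Build K A repalg *:%R (repl b) (rep_linl b).

(* The grading determined by |x_b| = |x| + |b|. *)
Inductive rep_hpart : int -> set repalg :=
| RepHpart0 p : rep_hpart p 0
| RepHpart1 : rep_hpart 0 1
| RepHpartSym p q x b of hpart p x & hpart q b : rep_hpart (p + q) (rep x b)
| RepHpartLin p a u v of rep_hpart p u & rep_hpart p v : rep_hpart p (a *: u + v)
| RepHpartMul p q u v of rep_hpart p u & rep_hpart q v : rep_hpart (p + q) (u * v).

Lemma rep_hpart_span (u : repalg) : exists2 s : seq repalg,
  (forall v, v \in s -> exists p, rep_hpart p v) & u = \sum_(v <- s) v.
Proof.
pose sp (u : repalg) := exists2 s : seq repalg,
  (forall v, v \in s -> exists p, rep_hpart p v) & u = \sum_(v <- s) v.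
have sp0 : sp 0 by exists [::]; rewrite ?big_nil.
have spD v w : sp v -> sp w -> sp (v + w).
  move=> [s sh ->] [r rh ->]; exists (s ++ r); last by rewrite big_cat.
  by move=> x; rewrite mem_cat => /orP[/sh|/rh].
have spM v w : sp v -> sp w -> sp (v * w).
  move=> [s sh ->] [r rh ->]; exists [seq x * y | x <- s, y <- r].
    move=> z /allpairsP[[x y] [/sh[p xp] /rh[q yq] ->]].
    by exists (p + q); constructor.
  rewrite big_allpairs_dep mulr_suml; apply: eq_bigr => x _.
  by rewrite mulr_sumr.
have spZ a v : sp v -> sp (a *: v).
  move=> [s sh ->]; exists [seq a *: x | x <- s]; last by rewrite big_map scaler_sumr.
  move=> x /mapP[y /sh[p yp] ->]; exists p; rewrite -[_ *: _]addr0.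
  by do 2?constructor.
have spS (T : eqType) (r : seq T) (F : T -> repalg) :
    (forall i, i \in r -> sp (F i)) -> sp (\sum_(i <- r) F i).
  by move=> FS; rewrite big_seq; elim/big_ind: _.
have sp1 : sp 1.
  exists [:: 1]; last by rewrite big_seq1.
  by move=> v; rewrite inE => /eqP ->; exists 0; constructor.
have sprep x b : sp (rep x b).
  have [sx sxh ex] := hpart_span x; have [sb sbh eb] := hpart_span b.
  rewrite -[rep x b]/(repl b x) ex linear_sum; apply: (@spS) => y /sxh[p yp].
  change (sp (rep y b)); rewrite eb linear_sum; apply: (@spS) => c /sbh[q cq].
  exists [:: rep y c]; last by rewrite big_seq1.
  by move=> v; rewrite inE => /eqP ->; exists (p + q); constructor.
have spW w : sp (rpi << w >>); last first.
  have [f ->] := qpi_surj u; rewrite (monalgE f) raddf_sum; apply: (@spS) => w _.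
  rewrite malgU_scale.
  change (sp (rpi (f@_w *: << w >>))); have -> : rpi (f@_w *: << w >>) = f@_w *: rpi << w >> by exact: linearZ.
  exact: spZ.
case: w => w; elim: w => [|[x b] w IHw].
  have -> : << FMonom [::] >> = (1 : freealg) by rewrite -fmoneE.
  exact: sp1.
have -> : << FMonom ((x, b) :: w) >> = fsym x b * << FMonom w >>.
  rewrite /fsym malgM_def fgmulUU mulr1; congr << _ >>.
  by rewrite /mmul /= fmuE fmmulE.
by rewrite -(rpi_mul (fsym x b)); apply: (spM _ _ (sprep x b) IHw).
Qed.

HB.instance Definition _ := hasDegrees.Build K repalg
  RepHpart0 RepHpartLin rep_hpart_span.
HB.instance Definition _ := isDegMultiplicative.Build K repalg
  RepHpart1 RepHpartMul.
End RepresentationAlgebra.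

(* Main.v *)
Require Import Defs.
From HB Require Import structures.
From mathcomp Require Import all_boot all_algebra.
From mathcomp Require Import finmap boolp classical_sets functions monalg.

(** In the defining formula fix the components x', x'', y', y'' and the sign.
    What depends on b' and c'' is then only the index of rho(x', y'), and this
    index is the value at (b', c'') of the bilinear map

      kappa(b, d) = (d . b^(2)) s(b^(3)) b^(1)   on B x B,

    where . is the pairing of t. Since B is ungraded, the signs never interact
    with B, and both claims become claims on [kappa].

    The formula in terms of t. As a function of b, kappa(b, d) vanishes at 1
    and on I^2 ([kappa1], [kappaM]), so it factors through p : B -> I/I^2.
    That t is trace-like gives p(b) = (b . t') p(t''), whence
    kappa(b, d) = (b . t') kappa(t'', d). The iterated coproducts of t are
    invariant under cyclic permutations, and rotating the factors gives
    kappa(b, d) = (b . t^(2)) (d . t^(4)) s(t^(1)) t^(3)  ([kappa_trace]). The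
    same argument for the derivation (b . -) shows that the pairing is symmetric
    ([trace_formC]), and rotating t by two factors shows that s exchanges the
    arguments of kappa ([kappa_antipode]); this is the balancing property
    kappa(b, d) = (b . d^(2)) s(d^(1)) d^(3)  ([kappa_dual]).

    Equivariance. The two sides of the equivariance condition satisfy the same
    Leibniz rules in both arguments, so it suffices to compare them on the
    generators x_b ([equiv_induction]). There the antipodes introduced by the
    coactions on rho(x', y') and on x'' cancel against each other
    ([adjoint_kappa]), the balancing property cancels those which come from y'',
    and both sides reduce to one expression, [core_coaction].

    Computations in Sweedler notation with a single element b are made in the
    convolution algebras of linear maps B -> C. There the identity and the
    antipode are mutually inverse, and this remains so after composition with an
    algebra homomorphism; associativity and such cancellations take the place of
    the renumbering of tensor factors. *)

Set Implicit Arguments.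
Unset Strict Implicit.
Unset Printing Implicit Defensive.

Import GRing.Theory.
Local Open Scope ring_scope.

(** * Linear maps out of quotients and tensor products *)

Section QuotientLift.
Variables (K : comNzRingType) (V P : lmodType K).

Lemma linear_eq0_lspan (S : set V) (f : {linear V -> P}) :
  (forall x, S x -> f x = 0) -> forall x, x \in lspan S -> f x = 0.
Proof.
move=> fS x /asboolP[s sS ->]; rewrite linear_sum big1_seq // => w /andP[_ /sS /fS e].
by rewrite linearZ_LR e scaler0.
Qed.

Lemma qlift_ex (S : set V) (f : {linear V -> P}) :
  (forall x, S x -> f x = 0) ->
  exists g : {linear quotmod S -> P}, forall x, g (qpi S x) = f x.
Proof.
move=> fS; pose g (u : quotmod S) := f (repr u).
have gE x : g (qpi S x) = f x.
  apply/eqP; rewrite -subr_eq0 -linearB; apply/eqP; apply: (linear_eq0_lspan fS).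
  by apply/qpiP; rewrite /qpi reprK.
have gl : linear g.
  move=> a u v; have [x ->] := qpi_surj u; have [y ->] := qpi_surj v.
  by rewrite -linearP !gE linearP.
pose gL := GRing.isLinear.Build K (quotmod S) P *:%R g gl.
pose gg : {linear quotmod S -> P} := HB.pack g gL.
by exists gg.
Qed.
End QuotientLift.

Lemma linear_ext (K : comNzRingType) (U V : lmodType K) (f g : {linear U -> V}) :
  f =1 g -> f = g.
Proof.
case: f => f [[a1] [a2]]; case: g => g [[b1] [b2]] /= /funext e; subst g.
by congr (GRing.Linear.Pack (GRing.Linear.Class _ _)); congr (_ _); exact: Prop_irrelevance.
Qed.

Section TensorLift.
Variables (K : comNzRingType) (M N P : lmodType K).

(** The formal combinations of elements of [T] form the free module on [T]. *)
Lemma malg_lift_ex (T : choiceType) (F : T -> P) :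
  exists f : {linear {malg K[T]} -> P}, forall k, f << k >> = F k.
Proof.
pose f (g : {malg K[T]}) := \sum_(k <- enum_fset (msupp g)) g@_k *: F k.
have fw (d : {fset T}) g : fsubset (msupp g) d ->
    f g = \sum_(k <- enum_fset d) g@_k *: F k.
  move=> le; rewrite /f (big_fset_incl _ le) // => x _ /mcoeff_outdom ->.
  by rewrite scale0r.
have fl : linear f.
  move=> a g h; pose d := fsetU (msupp g) (msupp h).
  have gd : fsubset (msupp g) d by exact: fsubsetUl.
  have hd : fsubset (msupp h) d by exact: fsubsetUr.
  have ghd : fsubset (msupp (a *: g + h)) d.
    apply: (fsubset_trans (msuppD_le _ _)); rewrite fsubUset hd andbT.
    exact: (fsubset_trans (msuppZ_le _ _)).
  rewrite (fw _ _ gd) (fw _ _ hd) (fw _ _ ghd) scaler_sumr -big_split /=.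
  by apply: eq_bigr => k _; rewrite mcoeffD mcoeffZ scalerDl scalerA.
pose fL := GRing.isLinear.Build K {malg K[T]} P *:%R f fl.
pose ff : {linear {malg K[T]} -> P} := HB.pack f fL.
exists ff => k; rewrite -[LHS]/(f _) (fw [fset k]%fset) ?msuppU_le // big_seq_fset1 mcoeffUU.
by rewrite scale1r.
Qed.

Lemma tensor_lift_ex (F : M -> N -> P) : bilinear_map F ->
  exists f : {linear tensor M N -> P}, forall m n, f (tens m n) = F m n.
Proof.
move=> [Fr Fl]; have [f fE] := malg_lift_ex (fun w : M * N => F w.1 w.2).
have [|g gE] := @qlift_ex K _ P (@tensor_rel K M N) f.
  move=> _ [a m m' n|a m n n'].
    by rewrite !linearB linearZ_LR /tgen !fE /= Fl addrAC addrK subrr.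
  by rewrite !linearB linearZ_LR /tgen !fE /= Fr addrAC addrK subrr.
by exists g => m n; rewrite /tens gE /tgen fE.
Qed.

Lemma tensor_ext (f g : {linear tensor M N -> P}) :
  (forall m n, f (tens m n) = g (tens m n)) -> f =1 g.
Proof.
move=> e u; have [s ->] := tensor_span u.
by rewrite !linear_sum; apply: eq_bigr => w _; exact: e.
Qed.
End TensorLift.

Section Tsum.
Variables (K : comNzRingType) (M N : degModType K).

(** Any linear map on [tensor M N] can be evaluated on the decomposition into
    homogeneous tensors that [tsum] picks. Together with [tensor_lift_ex] this
    makes [tsum u F] independent of that decomposition when [F] is bilinear. *)
Lemma tsum_lift (P : lmodType K) (f : {linear tensor M N -> P}) (u : tensor M N) :
  f u = tsum u (fun m n => f (tens m n)).
Proof. by have [_ {1}->] := hrepP u; rewrite linear_sum. Qed.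

Lemma tsum_linear (P : lmodType K) (F : M -> N -> P) : bilinear_map F ->
  linear (fun u => tsum u F).
Proof.
move=> /tensor_lift_ex[f fE] a u v.
have e w : tsum w F = f w by rewrite tsum_lift; apply: eq_bigr => k _; rewrite fE.
by rewrite !e linearP.
Qed.

Lemma tsum_tens (P : lmodType K) (F : M -> N -> P) m n : bilinear_map F ->
  tsum (tens m n) F = F m n.
Proof.
move=> /tensor_lift_ex[f fE].
have e w : tsum w F = f w by rewrite tsum_lift; apply: eq_bigr => k _; rewrite fE.
by rewrite e fE.
Qed.

Lemma eq_tsum (P : nmodType) (F G : M -> N -> P) u : (forall m n, F m n = G m n) ->
  tsum u F = tsum u G.
Proof. by move=> e; apply: eq_bigr => w _; rewrite e. Qed.

Lemma linear_tsum (P P' : lmodType K) (f : {linear P -> P'}) (F : M -> N -> P) u :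
  f (tsum u F) = tsum u (fun m n => f (F m n)).
Proof. exact: linear_sum. Qed.

Lemma tsumZ (P : lmodType K) a (F : M -> N -> P) u :
  a *: tsum u F = tsum u (fun m n => a *: F m n).
Proof. exact: scaler_sumr. Qed.

End Tsum.

Lemma tsum_tsum (K : comNzRingType) (M N M' N' : degModType K) (P : lmodType K)
  (F : M -> N -> P) (u : tensor M' N') (G : M' -> N' -> tensor M N) : bilinear_map F ->
  tsum (tsum u G) F = tsum u (fun m n => tsum (G m n) F).
Proof.
move=> /tensor_lift_ex[f fE].
have e w : tsum w F = f w by rewrite tsum_lift; apply: eq_tsum => k l; rewrite fE.
by rewrite e linear_tsum; apply: eq_tsum => m n; rewrite e.
Qed.

Lemma linear_scale (K : comNzRingType) (V W : lmodType K) (f : V -> W) a x :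
  linear f -> f (a *: x) = a *: f x.
Proof.
move=> fl; pose L : {linear V -> W} := HB.pack f (GRing.isLinear.Build K V W *:%R f fl).
exact: (linearZ_LR L).
Qed.

Lemma tsum_fun (K : comNzRingType) (V W : lmodType K) (f : V -> W) (M N : degModType K)
    (u : tensor M N) (F : M -> N -> V) : linear f ->
  tsum u (fun m n => f (F m n)) = f (tsum u F).
Proof.
move=> fl; pose L : {linear V -> W} := HB.pack f (GRing.isLinear.Build K V W *:%R f fl).
exact: (esym (linear_tsum L F u)).
Qed.

Lemma tsumD (K : comNzRingType) (M N : degModType K) (P : lmodType K) (u : tensor M N)
    (F G : M -> N -> P) : tsum u F + tsum u G = tsum u (fun m n => F m n + G m n).
Proof. by rewrite /tsum -big_split. Qed.

Lemma tsum0 (K : comNzRingType) (P : nmodType) (M N : degModType K) (u : tensor M N) :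
  tsum u (fun _ _ => 0 : P) = 0.
Proof. exact: big1. Qed.

Lemma exchange_tsum (K : comNzRingType) (M N M' N' : degModType K) (P : nmodType)
  (u : tensor M N) (v : tensor M' N') (F : M -> N -> M' -> N' -> P) :
  tsum u (fun m n => tsum v (fun m' n' => F m n m' n'))
  = tsum v (fun m' n' => tsum u (fun m n => F m n m' n')).
Proof. exact: exchange_big. Qed.

Lemma exchange_sw3 (K : comNzRingType) (A B : gradedBialgType K) (P : nmodType) (a : A) (b : B)
    (F : A -> A -> A -> B -> B -> B -> P) :
  sw3 a (fun a1 a2 a3 => sw3 b (fun b1 b2 b3 => F a1 a2 a3 b1 b2 b3))
  = sw3 b (fun b1 b2 b3 => sw3 a (fun a1 a2 a3 => F a1 a2 a3 b1 b2 b3)).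
Proof.
transitivity (sw2 a (fun a1 a' => sw3 b (fun b1 b2 b3 => sw2 a' (fun a2 a3 =>
  F a1 a2 a3 b1 b2 b3)))).
  apply: eq_tsum => a1 a'; rewrite /sw3 /sw2 exchange_tsum; apply: eq_tsum => b1 b'.
  exact: exchange_tsum.
rewrite /sw3 /sw2 exchange_tsum; apply: eq_tsum => b1 b'; exact: exchange_tsum.
Qed.

Lemma exchange_sw32 (K : comNzRingType) (A B : gradedBialgType K) (P : nmodType) (a : A) (b : B)
    (F : A -> A -> A -> B -> B -> P) :
  sw3 a (fun a1 a2 a3 => sw2 b (fun b1 b2 => F a1 a2 a3 b1 b2))
  = sw2 b (fun b1 b2 => sw3 a (fun a1 a2 a3 => F a1 a2 a3 b1 b2)).
Proof.
transitivity (sw2 a (fun a1 a' => sw2 b (fun b1 b2 => sw2 a' (fun a2 a3 => F a1 a2 a3 b1 b2)))).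
  by apply: eq_tsum => a1 a'; exact: exchange_tsum.
exact: exchange_tsum.
Qed.

Lemma linear_tsumr (K : comNzRingType) (M N: degModType K) (V P : lmodType K) (u : tensor M N)
  (F : V -> M -> N -> P)
  : (forall m n, linear (fun x => F x m n)) -> linear (fun x => tsum u (F x)).
Proof.
move=> Fl a x y; rewrite tsumZ /tsum -big_split; apply: eq_bigr => w _; exact: Fl.
Qed.

(** The lemmas below, one for each operation, feed the tactic [lin], which proves
    that a composite expression is linear in a variable. *)
Section LinearFunctions.
Variables (K : comNzRingType) (U V W : lmodType K).

Lemma lin_id : linear (fun x : U => x).
Proof. by []. Qed.

Lemma lin_app (g : {linear V -> W}) (f : U -> V) : linear f -> linear (fun x => g (f x)).
Proof. by move=> fl a x y; rewrite fl linearP. Qed.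

Lemma lin_comp (g : V -> W) (f : U -> V) : linear g -> linear f -> linear (fun x => g (f x)).
Proof. by move=> gl fl a x y; rewrite fl gl. Qed.

Lemma lin_scale (f : U -> V) k : linear f -> linear (fun x => k *: f x).
Proof. by move=> fl a x y; rewrite fl scalerDr !scalerA mulrC. Qed.

Lemma lin_add (f g : U -> V) : linear f -> linear g -> linear (fun x => f x + g x).
Proof. by move=> fl gl a x y; rewrite fl gl scalerDr addrACA. Qed.

Lemma lin_scalel (f : U -> K) (v : V) : scalar f -> linear (fun x => f x *: v).
Proof. by move=> fl a x y; rewrite fl scalerDl scalerA. Qed.

Lemma lin_mull (A : algType K) (f : U -> A) (v : A) : linear f -> linear (fun x => f x * v).
Proof. by move=> fl a x y; rewrite fl mulrDl scalerAl. Qed.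

Lemma lin_mulr (A : algType K) (f : U -> A) (v : A) : linear f -> linear (fun x => v * f x).
Proof. by move=> fl a x y; rewrite fl mulrDr scalerAr. Qed.

Lemma lin_tensr (f : U -> W) (v : V) : linear f -> linear (fun x => tens v (f x)).
Proof. by move=> fl a x y; rewrite fl linearP. Qed.

Lemma lin_tensl (f : U -> W) (v : V) : linear f -> linear (fun x => tens (f x) v).
Proof. by move=> fl a x y; rewrite fl tens_linl. Qed.
End LinearFunctions.

Lemma lin_tsum (K : comNzRingType) (U V : lmodType K) (M N : degModType K)
    (f : U -> tensor M N) (F : M -> N -> V) :
  bilinear_map F -> linear f -> linear (fun x => tsum (f x) F).
Proof. by move=> Fb; apply: lin_comp (tsum_linear Fb). Qed.

Lemma comul_linear (K : comNzRingType) (B : gradedBialgType K) : linear (@comul K B).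
Proof. by case: (@comul_hom K B). Qed.
HB.instance Definition _ (K : comNzRingType) (B : gradedBialgType K) :=
  GRing.isLinear.Build K B (tensor B B) *:%R comul (@comul_linear K B).
HB.instance Definition _ (K : comNzRingType) (B : gradedHopfType K) :=
  GRing.isLinear.Build K B B *:%R antipode (@antipode_linear K B).

(** * Algebras and tensor products of algebras *)

(** Associative unital algebras in which 1 = 0 is not excluded: the tensor product
    of two nonzero algebras over a commutative ring can vanish. *)
Record kalg (K : comNzRingType) := KAlg {
  alg_car :> lmodType K;
  kmul : alg_car -> alg_car -> alg_car;
  kone : alg_car;
  kmul_bilinear : bilinear_map kmul;
  kmulA : associative kmul;
  kmul1 : left_id kone kmul;
  kmulr1 : right_id kone kmul
}.
Arguments kone {K k}.
Notation "x ** y" := (kmul x y) (at level 40, left associativity) : ring_scope.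

Section KAlgTheory.
Variables (K : comNzRingType) (C : kalg K).
Implicit Types x y : C.

Lemma lin_kmull (U : lmodType K) (f : U -> C) y : linear f -> linear (fun u => f u ** y).
Proof.
move=> fl; apply: (@lin_comp _ _ _ _ (fun x => x ** y)) fl.
by have [_] := kmul_bilinear C; apply.
Qed.

Lemma lin_kmulr (U : lmodType K) (f : U -> C) x : linear f -> linear (fun u => x ** f u).
Proof.
move=> fl; apply: (@lin_comp _ _ _ _ (kmul x)) fl.
by have [h _] := kmul_bilinear C; apply: h.
Qed.

Definition kmulr_lin x : {linear C -> C} :=
  HB.pack (kmul x) (GRing.isLinear.Build K C C *:%R (kmul x) (proj1 (kmul_bilinear C) x)).
Definition kmull_lin y : {linear C -> C} :=
  HB.pack ((@kmul K C)^~ y)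
    (GRing.isLinear.Build K C C *:%R (fun x => x ** y) (proj2 (kmul_bilinear C) y)).

Lemma kscaleAl a x y : (a *: x) ** y = a *: (x ** y).
Proof. exact: (linearZ_LR (kmull_lin y)). Qed.

Lemma kscaleAr a x y : x ** (a *: y) = a *: (x ** y).
Proof. exact: (linearZ_LR (kmulr_lin x)). Qed.

Lemma kmulDl x y z : (x + y) ** z = x ** z + y ** z.
Proof. exact: (linearD (kmull_lin z)). Qed.
Lemma kmulDr x y z : z ** (x + y) = z ** x + z ** y.
Proof. exact: (linearD (kmulr_lin z)). Qed.
Lemma kmul0 x : 0 ** x = 0.
Proof. exact: (linear0 (kmull_lin x)). Qed.

Section Sums.
Variables (M N : degModType K) (u : tensor M N) (F : M -> N -> C).

Lemma ktsuml y : tsum u F ** y = tsum u (fun m n => F m n ** y).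
Proof. exact: (linear_tsum (kmull_lin y)). Qed.
Lemma ktsumr x : x ** tsum u F = tsum u (fun m n => x ** F m n).
Proof. exact: (linear_tsum (kmulr_lin x)). Qed.
End Sums.
End KAlgTheory.

(** Descends through the term until the variable is reached. The clauses are
    tried with backtracking, since a pattern can match a term to which the lemma of
    its clause does not apply. *)
Ltac lin_step := first [solve [auto] | by move=> ? ? ?; exact: linearP | match goal with
  | |- bilinear_map _ => split=> ? /=
  | |- forall _, _ => move=> ? /=
  | |- GRing.linear_for _ (fun x => x) => exact: lin_id
  | |- GRing.linear_for _ (fun x => ?k *: @?f x) => apply: (@lin_scale _ _ _ f k)
  | |- GRing.linear_for _ (fun x => @?f x *: ?v) => apply: (@lin_scalel _ _ _ f v)
  | |- GRing.linear_for _ (fun x => @?f x + @?g x) => apply: (@lin_add _ _ _ f g)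
  | |- GRing.linear_for _ (fun x => @?f x ** ?v) => apply: (@lin_kmull _ _ _ f v)
  | |- GRing.linear_for _ (fun x => ?v ** @?f x) => apply: (@lin_kmulr _ _ _ f v)
  | |- GRing.linear_for _ (fun x => @?f x * ?v) => apply: (@lin_mull _ _ _ f v)
  | |- GRing.linear_for _ (fun x => ?v * @?f x) => apply: (@lin_mulr _ _ _ f v)
  | |- GRing.linear_for _ (fun x => tens (@?f x) ?v) => apply: (@lin_tensl _ _ _ _ f v)
  | |- GRing.linear_for _ (fun x => tens ?v (@?f x)) => apply: (@lin_tensr _ _ _ _ f v)
  | |- GRing.linear_for _ (fun x => tsum ?v (@?f x)) => apply: (@linear_tsumr _ _ _ _ _ v f) => ? ? /=
  | |- GRing.linear_for _ (fun x => tsum (@?f x) ?F) => apply: (@lin_tsum _ _ _ _ _ f F)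
  | |- GRing.linear_for _ (fun x => ?g (@?f x)) => apply: (@lin_app _ _ _ _ g f)
  | |- GRing.linear_for _ (fun x => ?g (@?f x)) => apply: (@lin_comp _ _ _ _ g f); [solve [auto]|]
  | |- GRing.linear_for _ (fun x => ?g (@?f x) ?v) =>
      apply: (@lin_comp _ _ _ _ (fun z => g z v) f); [solve [auto]|]
  | |- GRing.linear_for ?s ?f => lazymatch f with
      | fun _ => _ => fail
      | _ => change (GRing.linear_for s (fun x => f x))
      end
  end].
Ltac lin := do ?lin_step.

(** The coassociativity axiom lives in B (x) (B (x) B); a trilinear map is a linear
    map on that module. *)
Lemma coassoc (K : comNzRingType) (B : gradedBialgType K) (P : lmodType K)
    (F : B -> B -> B -> P) (b : B) :
    (forall u v, linear (F u v)) -> (forall u w, linear (fun v => F u v w)) ->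
    (forall v w, linear (fun u => F u v w)) ->
  tsum (comul b) (fun b1 b2 => tsum (comul b1) (fun u v => F u v b2))
  = tsum (comul b) (fun b1 b2 => tsum (comul b2) (fun u v => F b1 u v)).
Proof.
move=> F3 F2 F1; have Fb u : bilinear_map (F u) by split=> ?; [exact: F3|exact: F2].
have [|h hE] := @tensor_lift_ex K B (tensor B B) P (fun u w => tsum w (F u)).
  by lin.
have eL : h (tsum (comul b) (fun x1 x2 => tsum (comul x1) (fun y1 y2 => tens y1 (tens y2 x2))))
    = tsum (comul b) (fun b1 b2 => tsum (comul b1) (fun u v => F u v b2)).
  rewrite linear_tsum; apply: eq_tsum => b1 b2.
  by rewrite linear_tsum; apply: eq_tsum => u v; rewrite hE tsum_tens.
rewrite -eL comulA linear_tsum; apply: eq_tsum => b1 b2; exact: hE.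
Qed.

(** The comultiplications nest to the right in [sw4]; here the first three factors
    are split off together. *)
Lemma sw4_regroup (K : comNzRingType) (B : gradedBialgType K) (P : lmodType K)
    (F : B -> B -> B -> B -> P) (b : B) :
    (forall b2 b3 b4, linear (fun b1 => F b1 b2 b3 b4)) ->
    (forall b1 b3 b4, linear (fun b2 => F b1 b2 b3 b4)) ->
    (forall b1 b2 b4, linear (fun b3 => F b1 b2 b3 b4)) ->
    (forall b1 b2 b3, linear (fun b4 => F b1 b2 b3 b4)) ->
  sw4 b F = sw2 b (fun b' b4 => sw3 b' (fun b1 b2 b3 => F b1 b2 b3 b4)).
Proof.
move=> F1 F2 F3 F4; rewrite /sw4 /sw3 /sw2.
rewrite (@coassoc _ _ _ (fun u v w => tsum (comul v) (fun b2 b3 => F u b2 b3 w))); try by lin.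
apply: eq_tsum => b1 b'.
by rewrite (@coassoc _ _ _ (fun u v w => F b1 u v w)); lin.
Qed.

Section Algebras.
Variable K : comNzRingType.

(** Transparent, so that multiplication in [plain_alg A] is convertible to
    multiplication in [A]. *)
Definition plain_alg (A : algType K) : kalg K.
Proof.
apply: (@KAlg K A *%R 1); [by lin|exact: mulrA|exact: mul1r|exact: mulr1].
Defined.

Section TensorAlgebra.
Variables M N : degAlgType K.

(** The multiplication without signs, which is the right one when [N] is
    concentrated in degree 0, see [tensor_mulE]. *)
Definition tmul (u v : tensor M N) : tensor M N :=
  tsum u (fun x b => tsum v (fun y c => tens (x * y) (b * c))).

Lemma tmul_bilinear : bilinear_map tmul.
Proof. by rewrite /tmul; lin. Qed.

Lemma tmul_tens x b y c : tmul (tens x b) (tens y c) = tens (x * y) (b * c).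
Proof. by rewrite /tmul !tsum_tens; lin. Qed.

Lemma tensor_bilinear_ext (P : lmodType K) (f g : tensor M N -> tensor M N -> P) :
  bilinear_map f -> bilinear_map g ->
  (forall m n m' n', f (tens m n) (tens m' n') = g (tens m n) (tens m' n')) ->
  forall u v, f u v = g u v.
Proof.
move=> [fr fl] [gr gl] e u v.
pose L (h : tensor M N -> P) (hl : linear h) : {linear tensor M N -> P} :=
  HB.pack h (GRing.isLinear.Build K (tensor M N) P *:%R h hl).
apply: (tensor_ext (f := L _ (fl v)) (g := L _ (gl v))) => m n.
apply: (tensor_ext (f := L _ (fr (tens m n))) (g := L _ (gr (tens m n)))) => m' n'.
exact: e.
Qed.

Lemma tmulA : associative tmul.
Proof.
have [tr tl] := tmul_bilinear.
move=> u v w.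
pose L (h : tensor M N -> tensor M N) (hl : linear h) : {linear tensor M N -> tensor M N} :=
  HB.pack h (GRing.isLinear.Build K (tensor M N) (tensor M N) *:%R h hl).
have tlvw : linear (fun u => tmul (tmul u v) w) by apply: (@lin_comp _ _ _ _ (tmul^~ w) (tmul^~ v)).
apply: (tensor_ext (f := L _ (tl (tmul v w))) (g := L _ tlvw)) => m n /=.
apply: (@tensor_bilinear_ext _ (fun v w => tmul (tens m n) (tmul v w))
  (fun v w => tmul (tmul (tens m n) v) w)).
- by split=> x; [apply: (@lin_comp _ _ _ _ (tmul (tens m n)) (tmul x))|
                 apply: (@lin_comp _ _ _ _ (tmul (tens m n)) (tmul^~ x))].
- by split=> x; [|apply: (@lin_comp _ _ _ _ (tmul^~ x) (tmul (tens m n)))].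
by move=> m' n' m'' n''; rewrite !tmul_tens !mulrA.
Qed.

Lemma tmulC : (forall x y : M, x * y = y * x) -> (forall x y : N, x * y = y * x) ->
  commutative tmul.
Proof.
move=> MC NC; have [tr tl] := tmul_bilinear.
apply: (@tensor_bilinear_ext _ tmul (fun u v => tmul v u)); [by []|by split|].
by move=> m n m' n'; rewrite !tmul_tens MC NC.
Qed.

Lemma tmul1 : left_id (tens 1 1) tmul.
Proof.
move=> u; rewrite /tmul tsum_tens; last by lin.
by rewrite [RHS](hrepP u).2; apply: eq_tsum => m n; rewrite !mul1r.
Qed.

Lemma tmulr1 : right_id (tens 1 1) tmul.
Proof.
move=> u; rewrite /tmul [RHS](hrepP u).2; apply: eq_tsum => m n.
by rewrite tsum_tens ?mulr1 //; lin.
Qed.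

Definition tensor_alg : kalg K := KAlg tmul_bilinear tmulA tmul1 tmulr1.

Definition tinl (m : M) : tensor_alg := tens m 1.
Definition tinr (n : N) : tensor_alg := tens 1 n.
Lemma tinl_linear : linear tinl. Proof. exact: (tens_linl 1). Qed.
Lemma tinr_linear : linear tinr. Proof. exact: (tens_linr 1). Qed.
HB.instance Definition _ := GRing.isLinear.Build K M tensor_alg *:%R tinl tinl_linear.
HB.instance Definition _ := GRing.isLinear.Build K N tensor_alg *:%R tinr tinr_linear.

Lemma tensE m n : tens m n = tinl m ** tinr n.
Proof. by rewrite -[RHS]/(tmul _ _) tmul_tens mulr1 mul1r. Qed.

Lemma tinlrC m n : tinl m ** tinr n = tinr n ** tinl m.
Proof. by rewrite -[LHS]/(tmul _ _) -[RHS]/(tmul _ _) !tmul_tens !mulr1 !mul1r. Qed.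

Lemma tinlM m n : tinl (m * n) = tinl m ** tinl n.
Proof. by rewrite -[RHS]/(tmul _ _) tmul_tens mulr1. Qed.

Lemma tinrM m n : tinr (m * n) = tinr m ** tinr n.
Proof. by rewrite -[RHS]/(tmul _ _) tmul_tens mulr1. Qed.

Lemma tinr_central n u : (forall b c : N, b * c = c * b) -> tinr n ** u = u ** tinr n.
Proof.
move=> NC; rewrite (hrepP u).2 ktsumr ktsuml; apply: eq_tsum => x b.
by rewrite tensE -kmulA -tinrM NC tinrM !kmulA tinlrC.
Qed.

End TensorAlgebra.
End Algebras.

(** * Convolution *)

Section Convolution.
Variables (K : comNzRingType) (B : gradedBialgType K).

Section Def.
Variable C : kalg K.
Definition conv_fun (f g : B -> C) (b : B) : C :=
  tsum (comul b) (fun b1 b2 => f b1 ** g b2).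

Lemma conv_linear (f g : {linear B -> C}) : linear (conv_fun f g).
Proof. by rewrite /conv_fun; lin. Qed.
HB.instance Definition _ (f g : {linear B -> C}) :=
  GRing.isLinear.Build K B C *:%R (conv_fun f g) (conv_linear f g).
Definition conv (f g : {linear B -> C}) : {linear B -> C} := conv_fun f g.

Definition scalar_map_fun (mu : B -> K) (b : B) : C := mu b *: kone.
Lemma scalar_map_linear (mu : {scalar B}) : linear (scalar_map_fun mu).
Proof. by move=> a x y; rewrite /scalar_map_fun linearP scalerDl scalerA. Qed.
HB.instance Definition _ (mu : {scalar B}) :=
  GRing.isLinear.Build K B C *:%R (scalar_map_fun mu) (scalar_map_linear mu).
Definition scalar_map (mu : {scalar B}) : {linear B -> C} := scalar_map_fun mu.
Definition conv_one : {linear B -> C} := scalar_map counit.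
End Def.
Local Notation "f \conv g" := (conv f g) (at level 40, left associativity).

Lemma convE (C : kalg K) (f g : {linear B -> C}) b :
  (f \conv g) b = tsum (comul b) (fun b1 b2 => f b1 ** g b2).
Proof. by []. Qed.

Section Theory.
Variables (C D : kalg K).
Implicit Types f g h : {linear B -> C}.

Lemma convA f g h : f \conv (g \conv h) = f \conv g \conv h.
Proof.
apply: linear_ext => b; rewrite !convE.
have -> : tsum (comul b) (fun b1 b2 => (f \conv g) b1 ** h b2) =
    tsum (comul b) (fun b1 b2 => tsum (comul b1) (fun u v => f u ** g v ** h b2)).
  by apply: eq_tsum => b1 b2; rewrite convE ktsuml.
rewrite (@coassoc _ _ _ (fun u v w => f u ** g v ** h w)); try by lin.
apply: eq_tsum => b1 b2; rewrite convE ktsumr; apply: eq_tsum => u v; exact: kmulA.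
Qed.

Lemma conv1l f : conv_one C \conv f = f.
Proof.
apply: linear_ext => b; rewrite convE -[in RHS](counitl b) linear_tsum.
by apply: eq_tsum => b1 b2; rewrite kscaleAl kmul1 linearZ_LR.
Qed.

Lemma conv1r f : f \conv conv_one C = f.
Proof.
apply: linear_ext => b; rewrite convE -[in RHS](counitr b) linear_tsum.
by apply: eq_tsum => b1 b2; rewrite kscaleAr kmulr1 linearZ_LR.
Qed.

Lemma conv_inv_uniq f g h : f \conv g = conv_one C -> g \conv h = conv_one C -> f = h.
Proof. by move=> fg gh; rewrite -[f]conv1r -gh convA fg conv1l. Qed.

Definition alg_hom (phi : {linear C -> D}) : Prop :=
  phi kone = kone /\ forall x y, phi (x ** y) = phi x ** phi y.

(** Composition as an operation on linear maps [B -> C], which for an algebra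
    homomorphism [phi] is multiplicative for convolution. *)
Definition post (phi : {linear C -> D}) (f : {linear B -> C}) : {linear B -> D} := phi \o f.

Lemma post_conv (phi : {linear C -> D}) f g : alg_hom phi ->
  post phi (f \conv g) = post phi f \conv post phi g.
Proof.
move=> [_ pM]; apply: linear_ext => b; rewrite convE -[LHS]/(phi (conv f g b)) convE linear_tsum.
by apply: eq_tsum => b1 b2; exact: pM.
Qed.

Lemma post_scalar_map (phi : {linear C -> D}) (mu : {scalar B}) : alg_hom phi ->
  post phi (scalar_map C mu) = scalar_map D mu.
Proof. by move=> [p1 _]; apply: linear_ext => b; rewrite /= linearZ_LR p1. Qed.
End Theory.
End Convolution.
Notation "f \conv g" := (conv f g) (at level 40, left associativity).
Arguments scalar_map {K B C} mu.
Arguments conv_one {K B C}.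

(** * Commutative Hopf algebras in degree 0 *)

Section Ungraded.
Variable K : comNzRingType.

Lemma ungraded_hpart (N : gradedModType K) (p : int) (x : N) :
  ungraded N -> p != 0 -> hpart p x -> x = 0.
Proof.
move=> Nu p0 xp.
have h := @hpart_direct K N [:: p; 0] (fun q => if q == p then x else if q == 0 then - x else 0).
move: h; rewrite !big_cons big_nil !eqxx [0 == p]eq_sym (negbTE p0) addr0 subrr => h.
have := h _ _ erefl p; rewrite /= !inE eqxx p0; apply => // q.
by case: eqP => [->//|_]; case: eqP => [->|_]; [exact: Nu|exact: hpart0].
Qed.

Lemma deg_ungraded (N : gradedModType K) (x : N) : ungraded N -> x != 0 -> deg x = 0.
Proof.
move=> Nu x0; have xp : hpart (deg x) x.
  by apply: (@xgetPex _ 0 [set p | hpart p x]%classic); exists 0; exact: Nu.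
by apply: contraNeq x0 => d0; rewrite (ungraded_hpart Nu d0 xp).
Qed.

(** The sign in [tensor_mul] depends on [deg b], which is 0 unless [b = 0]; in
    that case its value is arbitrary, but the tensor vanishes. *)
Lemma tensor_mulE (A : degAlgType K) (N : gradedAlgType K) (u v : tensor A N) :
  ungraded N -> tensor_mul u v = tmul u v.
Proof.
move=> Nu; apply: eq_tsum => x b; apply: eq_tsum => y c.
have [->|b0] := eqVneq b 0; first by rewrite mul0r linear0 scaler0.
by rewrite (deg_ungraded Nu b0) mul0r scale1r.
Qed.
End Ungraded.

Section CommutativeHopf.
Variables (K : comNzRingType) (B : gradedHopfType K).
Hypotheses (Bu : ungraded B) (Bc : graded_commutative B).

Lemma ungraded_mulC (x y : B) : x * y = y * x.
Proof. by have := Bc (Bu x) (Bu y); rewrite mul0r scale1r. Qed.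

Lemma comulM (x y : B) : comul (x * y) = tmul (comul x) (comul y).
Proof. by have [_ _ _ ->] := @comul_hom K B; rewrite tensor_mulE. Qed.

Lemma comul1 : comul (1 : B) = tens 1 1.
Proof. by have [] := @comul_hom K B. Qed.

Lemma tsum_comulM (P : lmodType K) (F : B -> B -> P) x y : bilinear_map F ->
  tsum (comul (x * y)) F =
  tsum (comul x) (fun x1 x2 => tsum (comul y) (fun y1 y2 => F (x1 * y1) (x2 * y2))).
Proof.
move=> Fb; rewrite comulM /tmul tsum_tsum //; apply: eq_tsum => x1 x2.
by rewrite tsum_tsum //; apply: eq_tsum => y1 y2; rewrite tsum_tens.
Qed.

Section BilinearConvolution.
Variable C : kalg K.

(** Convolution on the coalgebra B (x) B, written for bilinear maps on B x B. *)
Definition conv2 (F G : B -> B -> C) x y :=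
  tsum (comul x) (fun x1 x2 => tsum (comul y) (fun y1 y2 => F x1 y1 ** G x2 y2)).

Lemma conv2A (F G H : B -> B -> C) x y : bilinear_map F -> bilinear_map G -> bilinear_map H ->
  conv2 F (conv2 G H) x y = conv2 (conv2 F G) H x y.
Proof.
move=> [Fr Fl] [Gr Gl] [Hr Hl].
pose T x1 x2 x3 := tsum (comul y) (fun y1 y2 => tsum (comul y2)
  (fun y2 y3 => F x1 y1 ** G x2 y2 ** H x3 y3)).
transitivity (tsum (comul x) (fun x1 x2 => tsum (comul x2) (fun x2 x3 => T x1 x2 x3))).
  apply: eq_tsum => x1 x2; rewrite /conv2 /T -exchange_tsum; apply: eq_tsum => y1 y2.
  rewrite ktsumr; apply: eq_tsum => x3 x4.
  by rewrite ktsumr; apply: eq_tsum => y3 y4; rewrite kmulA.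
transitivity (tsum (comul x) (fun x1 x3 => tsum (comul x1) (fun x1 x2 => T x1 x2 x3))).
  by symmetry; apply: coassoc; rewrite /T; lin.
apply: eq_tsum => x1 x3; rewrite /conv2 /T.
transitivity (tsum (comul x1) (fun x1 x2 => tsum (comul y) (fun y1 y2 => tsum (comul y1)
  (fun y1 y3 => F x1 y1 ** G x2 y3 ** H x3 y2)))).
  apply: eq_tsum => x2 x4; symmetry.
  by apply: (@coassoc _ _ _ (fun y1 y2 y3 => F x2 y1 ** G x4 y2 ** H x3 y3)); lin.
rewrite exchange_tsum; apply: eq_tsum => y1 y2; rewrite ktsuml; apply: eq_tsum => x2 x4.
by rewrite ktsuml.
Qed.

Definition counit2 (x y : B) : C := (counit x * counit y) *: kone.

Lemma conv2_1l (F : B -> B -> C) x y : bilinear_map F -> conv2 counit2 F x y = F x y.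
Proof.
move=> [Fr Fl]; rewrite -[in RHS](counitl x) -(tsum_fun _ _ (Fl y)).
apply: eq_tsum => x1 x2; rewrite -[in RHS](counitl y) -(tsum_fun _ _ (Fr _)).
apply: eq_tsum => y1 y2.
by rewrite kscaleAl kmul1 (linear_scale _ _ (Fr _)) (linear_scale _ _ (Fl y2)) scalerA mulrC.
Qed.

Lemma conv2_1r (F : B -> B -> C) x y : bilinear_map F -> conv2 F counit2 x y = F x y.
Proof.
move=> [Fr Fl]; rewrite -[in RHS](counitr x) -(tsum_fun _ _ (Fl y)).
apply: eq_tsum => x1 x2; rewrite -[in RHS](counitr y) -(tsum_fun _ _ (Fr _)).
apply: eq_tsum => y1 y2.
by rewrite kscaleAr kmulr1 (linear_scale _ _ (Fr _)) (linear_scale _ _ (Fl y1)) scalerA mulrC.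
Qed.
End BilinearConvolution.

(** Both sides are convolution inverses of the multiplication B x B -> B, the left
    one on the left and the right one on the right. *)
Lemma antipodeM (x y : B) : antipode (x * y) = antipode x * antipode y.
Proof.
pose P (x y : B) : plain_alg B := antipode (x * y).
pose M (x y : B) : plain_alg B := x * y.
pose N (x y : B) : plain_alg B := antipode x * antipode y.
have Pb : bilinear_map P by rewrite /P; lin.
have Mb : bilinear_map M by rewrite /M; lin.
have Nb : bilinear_map N by rewrite /N; lin.
have PM u v : conv2 P M u v = counit2 (plain_alg B) u v.
  transitivity (tsum (comul (u * v)) (fun a b => antipode a * b)).
    by symmetry; apply: (tsum_comulM (F := fun a b => antipode a * b)); lin.
  by rewrite antipodel counitM.
have MN u v : conv2 M N u v = counit2 (plain_alg B) u v.
  have -> : counit2 (plain_alg B) u v = (counit u *: 1 : B) * (counit v *: 1).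
    by rewrite -scalerAl mul1r scalerA.
  rewrite -!antipoder; apply: (etrans _ (esym (ktsuml (C := plain_alg B) _ _ _))).
  apply: eq_tsum => u1 u2; apply: (etrans _ (esym (ktsumr (C := plain_alg B) _ _ _))).
  apply: eq_tsum => v1 v2.
  rewrite -[LHS]/(u1 * v1 * (antipode u2 * antipode v2)).
  rewrite -[RHS]/(u1 * antipode u2 * (v1 * antipode v2)).
  by rewrite !mulrA -(mulrA u1 v1) (ungraded_mulC v1) mulrA.
rewrite -[LHS]/(P x y) -[RHS]/(N x y) -(conv2_1r _ _ Pb) -(conv2_1l _ _ Nb).
have -> : counit2 (plain_alg B) = conv2 M N by apply/funext => u; apply/funext => v.
rewrite conv2A // (_ : conv2 P M = conv2 M N) //.
by apply/funext => u; apply/funext => v; rewrite PM -MN.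
Qed.
End CommutativeHopf.

(** The identity and the antipode of B appear below with several types: as
    elements of a convolution algebra ([id_map], [antipode_map]) and as algebra
    homomorphisms with which such elements are composed ([antipode_alg]). *)
Section HopfConvolution.
Variables (K : comNzRingType) (B : gradedHopfType K).
Notation BA := (plain_alg B).
Notation BB := (tensor_alg B B).

Definition id_map : {linear B -> BA} := idfun.
Definition antipode_map : {linear B -> BA} := @antipode K B.
Definition antipode_alg : {linear BA -> BA} := @antipode K B.
Definition inl_alg : {linear BA -> BB} := @tinl K B B.
Definition inr_alg : {linear BA -> BB} := @tinr K B B.

Lemma alg_hom_inl : alg_hom inl_alg.
Proof. by split=> // x y; exact: tinlM. Qed.
Lemma alg_hom_inr : alg_hom inr_alg.
Proof. by split=> // x y; exact: tinrM. Qed.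

Lemma conv_antipodel : antipode_map \conv id_map = conv_one.
Proof. by apply: linear_ext => b; exact: antipodel. Qed.
Lemma conv_antipoder : id_map \conv antipode_map = conv_one.
Proof. by apply: linear_ext => b; exact: antipoder. Qed.

Section Post.
Variables (C : kalg K) (phi : {linear BA -> C}) (h : alg_hom phi).
Lemma post_antipodel : post phi antipode_map \conv post phi id_map = conv_one.
Proof. by rewrite -post_conv // conv_antipodel post_scalar_map. Qed.
Lemma post_antipoder : post phi id_map \conv post phi antipode_map = conv_one.
Proof. by rewrite -post_conv // conv_antipoder post_scalar_map. Qed.
End Post.

Hypotheses (Bu : ungraded B) (Bc : graded_commutative B).

Lemma alg_hom_antipode : alg_hom antipode_alg.
Proof.
split; last by move=> x y; exact: antipodeM.
have := antipoder (1 : B); rewrite comul1 tsum_tens; last by lin.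
by rewrite mul1r counit1 scale1r.
Qed.

(** Composing [id_map \conv antipode_map = conv_one] with the algebra homomorphism
    s shows that s s is a right inverse of s; the identity is a left inverse. *)
Lemma antipodeK : post antipode_alg antipode_map = id_map.
Proof.
symmetry; apply: (conv_inv_uniq (g := antipode_map)); first exact: conv_antipoder.
rewrite -[X in X \conv _](_ : post antipode_alg id_map = antipode_map); last exact: linear_ext.
exact: (post_antipoder alg_hom_antipode).
Qed.

Lemma antipode_involutive (u : B) : antipode (antipode u) = u.
Proof. exact: (congr1 (fun f : {linear B -> BA} => f u) antipodeK). Qed.

End HopfConvolution.

(** * The pairing defined by a trace-like element *)

Section TraceForm.
Variables (K : comNzRingType) (B : gradedHopfType K) (t : B).

(** True for any [t], as the default value 0 is a derivation too. *)
Lemma trace_form_derivation b : derivations (trace_form t b).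
Proof.
rewrite /trace_form; case: xgetP => [_ -> []//|_].
by split=> [a x y|x y]; rewrite !mulr0 addr0.
Qed.
HB.instance Definition _ b :=
  GRing.isLinear.Build K B K *%R (trace_form t b) (proj1 (trace_form_derivation b)).

Lemma trace_formM b x y :
  trace_form t b (x * y) = counit x * trace_form t b y + counit y * trace_form t b x.
Proof. exact: (proj2 (trace_form_derivation b)). Qed.

Lemma trace_form1 b : trace_form t b 1 = 0.
Proof.
have := trace_formM b 1 1; rewrite !mul1r counit1 !mul1r => /eqP.
by rewrite -subr_eq0 opprD addrA subrr sub0r oppr_eq0 => /eqP.
Qed.

Hypothesis tl : trace_like t.

Lemma trace_formP b : trace_map t (trace_form t b) = cotangent_class b.
Proof.
have [_ [_ _ /(_ (cotangent_class b) I)[mu dmu mub]]] := tl.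
rewrite /trace_form; case: xgetP => [_ -> []//|/(_ mu) []]; by split.
Qed.

(** A linear map which behaves like a derivation vanishes at 1 and on I^2, so it
    can be applied to the identity p(b) = (b . t') p(t'') in I/I^2. *)
Lemma cotangent_factor (P : lmodType K) (f : {linear B -> P}) b :
  f 1 = 0 -> (forall x y, f (x * y) = counit x *: f y + counit y *: f x) ->
  f b = tsum (comul t) (fun t1 t2 => trace_form t b t1 *: f t2).
Proof.
move=> f1 fM; have vl : linear (fun x : augid B => f (augid_val x)).
  by move=> a x y; rewrite -linearP.
pose g : {linear augid B -> P} :=
  HB.pack (fun x : augid B => f (augid_val x)) (GRing.isLinear.Build K (augid B) P *:%R _ vl).
have [|h hE] := @qlift_ex K (augid B) P (@aug_product K B) g.
  move=> _ [[x ex] [y ey] z ez]; rewrite -[LHS]/(f (\val z)) ez fM /=.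
  by rewrite (eqP ex) (eqP ey) !scale0r addr0.
have hc c : h (cotangent_class c) = f c.
  rewrite [LHS]hE -[LHS]/(f (c - counit c *: 1)).
  by rewrite linearB linearZ_LR f1 scaler0 subr0.
rewrite -hc -trace_formP /trace_map /sw2 linear_tsum; apply: eq_tsum => t1 t2.
by rewrite linearZ_LR hc.
Qed.

Lemma comul_swap (P : lmodType K) (F : B -> B -> P) : bilinear_map F ->
  tsum (comul t) F = tsum (comul t) (fun t1 t2 => F t2 t1).
Proof.
move=> Fb; have [{1}-> _] := tl; rewrite /sw2 tsum_tsum //.
by apply: eq_tsum => t1 t2; rewrite tsum_tens.
Qed.

(** Applying the derivation (a . -) to p(d) = (d . t') p(t'') gives
    a . d = (d . t') (a . t''), which is symmetric since t is cosymmetric. *)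
Lemma trace_formC b c : trace_form t b c = trace_form t c b.
Proof.
have e a d : trace_form t a d =
    tsum (comul t) (fun t1 t2 => trace_form t d t1 * trace_form t a t2).
  apply: (@cotangent_factor K^o (trace_form t a : {linear B -> K^o}) d); first exact: trace_form1.
  exact: trace_formM.
rewrite e [RHS]e (@comul_swap K^o); last first.
  split=> z u x y; rewrite linearP; first by rewrite mulrDr mulrCA.
  by rewrite mulrDl -mulrA.
by apply: eq_tsum => t1 t2; rewrite mulrC.
Qed.

End TraceForm.

(** * The map kappa *)

Section Kappa.
Variables (K : comNzRingType) (B : gradedHopfType K).
Hypotheses (Bu : ungraded B) (Bc : graded_commutative B).
Notation BA := (plain_alg B).
Notation BB := (tensor_alg B B).

Lemma conv_cancel (C : kalg K) (f g h : {linear B -> C}) :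
  f \conv g = conv_one -> h \conv f \conv g = h.
Proof. by move=> e; rewrite -convA e conv1r. Qed.

Lemma conv_at1 (C : kalg K) (f g : {linear B -> C}) : (f \conv g) 1 = f 1 ** g 1.
Proof. by rewrite convE comul1 tsum_tens; lin. Qed.

Lemma conv_at_mul (C : kalg K) (f g : {linear B -> C}) x y :
  (f \conv g) (x * y) = tsum (comul x) (fun x1 x2 =>
    tsum (comul y) (fun y1 y2 => f (x1 * y1) ** g (x2 * y2))).
Proof.
by apply: (tsum_comulM Bu (F := fun a b => f a ** g b)); lin.
Qed.

(** In a commutative target, convolution commutes with products of functions of
    two separate variables. *)
Lemma conv_prod (C : kalg K) (f f' g g' : {linear B -> C}) x y : commutative (@kmul K C) ->
  tsum (comul x) (fun x1 x2 => tsum (comul y) (fun y1 y2 =>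
    (f x1 ** f' y1) ** (g x2 ** g' y2))) = (f \conv g) x ** (f' \conv g') y.
Proof.
move=> CC; rewrite !convE ktsuml; apply: eq_tsum => x1 x2.
rewrite ktsumr; apply: eq_tsum => y1 y2.
by rewrite !kmulA -(kmulA (f x1)) (CC (f' y1)) kmulA.
Qed.

Lemma alg_hom_conv (C : kalg K) (f g : {linear BA -> C}) : commutative (@kmul K C) ->
  alg_hom f -> alg_hom g -> alg_hom (f \conv g : {linear BA -> C}).
Proof.
move=> CC [f1 fM] [g1 gM]; split; first by rewrite conv_at1 f1 g1 kmul1.
move=> x y; rewrite conv_at_mul -(conv_prod f f) //.
by apply: eq_tsum => x1 x2; apply: eq_tsum => y1 y2; rewrite fM gM.
Qed.

Lemma plain_algC : commutative (@kmul K BA).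
Proof. exact: ungraded_mulC. Qed.

Lemma tensor_algC : commutative (@kmul K BB).
Proof. by apply: tmulC; apply: ungraded_mulC. Qed.

Variables (t : B) (tl : trace_like t).

(** [kappa d b] is (d . b^(2)) b^(1) s(b^(3)), the index of rho(x', y') in the
    defining formula of the bracket. *)
Definition kappa (d : B) : {linear B -> BA} :=
  id_map B \conv scalar_map (trace_form t d) \conv antipode_map B.

Lemma kappa1 d : kappa d 1 = 0.
Proof.
rewrite !conv_at1 [scalar_map _ 1](_ : _ = 0); last first.
  by rewrite /= /scalar_map_fun trace_form1 scale0r.
by rewrite -[LHS]/(1 * 0 * antipode 1) mulr0 mul0r.
Qed.

(** Of the factors b^(1), (d . b^(2)), s(b^(3)) the outer ones are multiplicative
    and the middle one is a derivation. So each of the two terms contains, for one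
    of the variables, the convolution of the identity with s, which is the counit. *)
Lemma kappaM d x y : kappa d (x * y) = counit x *: kappa d y + counit y *: kappa d x.
Proof.
pose D := scalar_map (trace_form t d) \conv antipode_map B.
pose m := scalar_map (C := BA) (trace_form t d); pose e := @conv_one K B BA.
have mM u v : m (u * v) = e u ** m v + m u ** e v.
  rewrite -[LHS]/(trace_form t d (u * v) *: kone) trace_formM.
  rewrite !kscaleAl !kscaleAr !kmul1 !scalerA -scalerDl.
  by congr ((_ + _) *: _); exact: mulrC.
have SM u v : antipode_map B (u * v) = antipode_map B u ** antipode_map B v by exact: antipodeM.
(* Writing s as the convolution of the counit with s gives both terms the shape
   required by [conv_prod]. *)
have SE w : antipode_map B w = (e \conv antipode_map B) w by rewrite conv1l.
have DM u v : D (u * v) = antipode_map B u ** D v + D u ** antipode_map B v.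
  rewrite [X in X ** D v]SE [X in D u ** X]SE conv_at_mul.
  rewrite -!conv_prod; try exact: plain_algC.
  rewrite tsumD; apply: eq_tsum => u1 u2; rewrite tsumD; apply: eq_tsum => v1 v2.
  by rewrite mM SM kmulDl.
have k u : kappa d u = (id_map B \conv D) u by rewrite /kappa /D convA.
have iE u (w : BA) : counit u *: w = (id_map B \conv antipode_map B) u ** w.
  by rewrite conv_antipoder kscaleAl kmul1.
rewrite !k !iE [X in _ + X]plain_algC conv_at_mul -!conv_prod; try exact: plain_algC.
rewrite tsumD; apply: eq_tsum => x1 x2; rewrite tsumD; apply: eq_tsum => y1 y2.
by rewrite DM kmulDr.
Qed.

(** Applied to iterated convolutions, this is the invariance of the iterated
    coproducts of t under cyclic permutations. *)
Lemma conv_swap (C : kalg K) (f g : {linear B -> C}) : commutative (@kmul K C) ->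
  (f \conv g) t = (g \conv f) t.
Proof.
move=> CC; rewrite !convE (comul_swap tl); last by lin.
by apply: eq_tsum => t1 t2; rewrite CC.
Qed.

(** Since kappa(b, d) depends only on p(b), it equals (b . t') kappa(t'', d);
    moving s from the last factor of t to the first one gives the claim. *)
Lemma kappa_trace d b :
  kappa d b = (antipode_map B \conv scalar_map (trace_form t b) \conv
               id_map B \conv scalar_map (trace_form t d)) t.
Proof.
rewrite -2!convA conv_swap; last exact: plain_algC.
have -> : scalar_map (trace_form t b) \conv (id_map B \conv scalar_map (trace_form t d))
      \conv antipode_map B
    = scalar_map (trace_form t b) \conv kappa d by rewrite /kappa !convA.
rewrite (cotangent_factor tl b (kappa1 d) (kappaM d)).
by rewrite convE; apply: eq_tsum => t1 t2; rewrite kscaleAl kmul1.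
Qed.

(** In [kappa_trace] the antipode turns s(t^(1)) t^(3) into t^(1) s(t^(3)), and
    rotating t by two factors exchanges the roles of b and d. *)
Lemma kappa_antipode d b : antipode (kappa d b) = kappa b d.
Proof.
rewrite -[LHS]/(antipode_alg B (kappa d b)) kappa_trace.
transitivity (post (antipode_alg B)
    (antipode_map B \conv scalar_map (trace_form t b) \conv id_map B \conv scalar_map (trace_form t d)) t).
  by [].
have hS := alg_hom_antipode Bu Bc.
rewrite !post_conv // !post_scalar_map // antipodeK //.
have -> : post (antipode_alg B) (id_map B) = antipode_map B by exact: linear_ext.
rewrite -convA conv_swap; last exact: plain_algC.
by rewrite kappa_trace convA.
Qed.

(** The balancing property of the pairing: kappa is also of the form
    (b . d^(2)) s(d^(1)) d^(3) in its other argument. *)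
Lemma kappa_dual d b :
  kappa d b = (antipode_map B \conv scalar_map (trace_form t b) \conv id_map B) d.
Proof.
rewrite -kappa_antipode; transitivity (post (antipode_alg B) (kappa b) d); first by [].
have hS := alg_hom_antipode Bu Bc.
by rewrite !post_conv // !post_scalar_map // antipodeK.
Qed.

(** The map b |-> b^(2) (x) s(b^(1)) b^(3), see [adjoint_sw3]. *)
Definition adjoint_coaction : {linear BA -> BB} :=
  post (inr_alg B) (antipode_map B) \conv post (inl_alg B) (id_map B)
  \conv post (inr_alg B) (id_map B).

Lemma alg_hom_adjoint : alg_hom adjoint_coaction.
Proof.
have [l1 lM] := alg_hom_inl B; have [r1 rM] := alg_hom_inr B.
have [S1 SM] := alg_hom_antipode Bu Bc.
have rS : alg_hom (post (inr_alg B) (antipode_map B) : {linear BA -> BB}).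
  split; first by rewrite -r1; congr (inr_alg B _).
  by move=> x y; rewrite -rM; congr (inr_alg B _); exact: SM.
apply: alg_hom_conv; [exact: tensor_algC| |exact: alg_hom_inr].
by apply: alg_hom_conv; [exact: tensor_algC|exact: rS|exact: alg_hom_inl].
Qed.

(** With i and j the two embeddings of B in B (x) B, the adjoint coaction is the
    convolution (j s) i j, and its composite with s is the inverse, (j s) (i s) j.
    Hence its composite with kappa(-, d) is (j s) i j (d . -) (j s) (i s) j, and
    multiplying by j on the left and by j s on the right leaves
    i j (d . -) (j s) (i s). *)
Lemma adjoint_kappa d :
  post (inr_alg B) (id_map B) \conv post adjoint_coaction (kappa d)
    \conv post (inr_alg B) (antipode_map B) =
  post (inl_alg B) (id_map B) \conv post (inr_alg B) (kappa d)
    \conv post (inl_alg B) (antipode_map B).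
Proof.
have hl := alg_hom_inl B; have hr := alg_hom_inr B; have ha := alg_hom_adjoint.
have adS : post adjoint_coaction (antipode_map B) =
    post (inr_alg B) (antipode_map B) \conv post (inl_alg B) (antipode_map B)
    \conv post (inr_alg B) (id_map B).
  symmetry; apply: (conv_inv_uniq (g := post adjoint_coaction (id_map B))); last exact: post_antipoder.
  have -> : post adjoint_coaction (id_map B) = adjoint_coaction by exact: linear_ext.
  rewrite /adjoint_coaction !convA (conv_cancel _ (post_antipoder hr)) (conv_cancel _ (post_antipodel hl)).
  by rewrite post_antipodel.
rewrite /kappa !(post_conv _ _ ha) !(post_conv _ _ hr) (post_scalar_map _ ha)
  (post_scalar_map _ hr) adS.
have -> : post adjoint_coaction (id_map B) = adjoint_coaction by exact: linear_ext.
rewrite /adjoint_coaction !convA (post_antipoder hr) conv1l (conv_cancel _ (post_antipoder hr)).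
by [].
Qed.
End Kappa.

(** * The two formulas for the bracket *)

Section Formulas.
Variables (K : comNzRingType) (B : gradedHopfType K) (R : algType K).
Hypotheses (Bu : ungraded B) (Bc : graded_commutative B).
Variables (t : B) (tl : trace_like t).

Lemma kappa_sw3 d b : kappa t d b =
  sw3 b (fun b1 b2 b3 => trace_form t d b2 *: (antipode b3 * b1)).
Proof.
rewrite /kappa -convA convE; apply: eq_tsum => b1 b'.
rewrite convE ktsumr; apply: eq_tsum => b2 b3.
by rewrite kscaleAl kmul1 kscaleAr (plain_algC Bu Bc).
Qed.

Lemma kappa_sw4 d b : kappa t d b =
  sw4 t (fun t1 t2 t3 t4 => (trace_form t b t2 * trace_form t d t4) *: (antipode t1 * t3)).
Proof.
rewrite kappa_trace // -2!convA convE; apply: eq_tsum => t1 t'.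
rewrite convE ktsumr; apply: eq_tsum => t2 t''.
rewrite kscaleAl kmul1 kscaleAr convE ktsumr tsumZ; apply: eq_tsum => t3 t4.
by rewrite kscaleAr kmulr1 kscaleAr scalerA.
Qed.

(** The bracket of x_b and y_c for fixed components of x and y, up to sign. The
    representation algebra is replaced by any algebra [R], and b |-> rho(x', y')_b,
    x''_b, y''_b by linear maps [r], [x], [y]. *)
Definition bracket_core (r x y : {linear B -> R}) (b c : B) : R :=
  tsum (comul b) (fun b1 b2 => tsum (comul c) (fun c1 c2 =>
    r (kappa t c2 b1) * x b2 * y c1)).

Lemma bracket_core_sw3 (r x y : {linear B -> R}) b c s :
  sw4 b (fun b1 b2 b3 b4 => sw2 c (fun c1 c2 => (s * trace_form t c2 b2) *:
    (r (antipode b3 * b1) * x b4 * y c1))) = s *: bracket_core r x y b c.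
Proof.
transitivity (tsum (comul c) (fun c1 c2 => sw4 b (fun b1 b2 b3 b4 => s *: (trace_form t c2 b2 *:
    (r (antipode b3 * b1) * x b4 * y c1))))).
  rewrite /sw4 /sw3 /sw2 exchange_tsum; apply: eq_tsum => b1 b'.
  rewrite exchange_tsum; apply: eq_tsum => b2 b''.
  rewrite exchange_tsum; apply: eq_tsum => b3 b4.
  by apply: eq_tsum => c1 c2; rewrite scalerA.
rewrite /bracket_core exchange_tsum tsumZ; apply: eq_tsum => c1 c2.
rewrite sw4_regroup; try by lin.
rewrite tsumZ; apply: eq_tsum => b' b4.
have lr : linear (fun z : B => s *: (r z * x b4 * y c1)) by lin.
rewrite kappa_sw3 -(tsum_fun _ _ lr); apply: eq_tsum => b1 b''.
rewrite -(tsum_fun _ _ lr); apply: eq_tsum => b2 b3.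
by rewrite [r (_ *: _)]linearZ_LR -!scalerAl.
Qed.

Lemma bracket_core_sw4 (r x y : {linear B -> R}) b c s :
  sw4 t (fun t1 t2 t3 t4 => sw2 b (fun b1 b2 => sw2 c (fun c1 c2 =>
    (s * trace_form t b1 t2 * trace_form t c2 t4) *:
    (r (antipode t1 * t3) * x b2 * y c1)))) = s *: bracket_core r x y b c.
Proof.
transitivity (tsum (comul b) (fun b1 b2 => tsum (comul c) (fun c1 c2 =>
  sw4 t (fun t1 t2 t3 t4 => (s * trace_form t b1 t2 * trace_form t c2 t4) *:
    (r (antipode t1 * t3) * x b2 * y c1))))).
  rewrite /sw4 /sw3 /sw2.
  transitivity (tsum (comul t) (fun t1 t' => tsum (comul b) (fun b1 b2 => tsum (comul c)
    (fun c1 c2 => tsum (comul t') (fun t2 t'' => tsum (comul t'') (fun t3 t4 =>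
    (s * trace_form t b1 t2 * trace_form t c2 t4) *:
    (r (antipode t1 * t3) * x b2 * y c1))))))).
    apply: eq_tsum => t1 t'.
    transitivity (tsum (comul t') (fun t2 t'' => tsum (comul b) (fun b1 b2 => tsum (comul c)
      (fun c1 c2 => tsum (comul t'') (fun t3 t4 =>
      (s * trace_form t b1 t2 * trace_form t c2 t4) *:
      (r (antipode t1 * t3) * x b2 * y c1)))))).
      apply: eq_tsum => t2 t''; apply: (etrans (exchange_tsum _ _ _)); apply: eq_tsum => b1 b2.
      exact: exchange_tsum.
    apply: (etrans (exchange_tsum _ _ _)); apply: eq_tsum => b1 b2; exact: exchange_tsum.
  apply: (etrans (exchange_tsum _ _ _)); apply: eq_tsum => b1 b2; exact: exchange_tsum.
rewrite /bracket_core tsumZ; apply: eq_tsum => b1 b2.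
rewrite tsumZ; apply: eq_tsum => c1 c2.
have lr : linear (fun z : B => s *: (r z * x b2 * y c1)) by lin.
rewrite kappa_sw4 -(tsum_fun _ _ lr); apply: eq_tsum => t1 t'.
rewrite -(tsum_fun _ _ lr); apply: eq_tsum => t2 t''.
rewrite -(tsum_fun _ _ lr); apply: eq_tsum => t3 t4.
by rewrite [r (_ *: _)]linearZ_LR -!scalerAl scalerA mulrA.
Qed.

End Formulas.

(** * Equivariance on generators *)

Lemma adjoint_sw3 (K : comNzRingType) (B : gradedHopfType K) (b : B) :
  adjoint_coaction B b = sw3 b (fun b1 b2 b3 => tens b2 (antipode b1 * b3)).
Proof.
rewrite /adjoint_coaction -convA convE; apply: eq_tsum => b1 b'.
rewrite convE ktsumr; apply: eq_tsum => b2 b3.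
rewrite -[LHS]/(tmul (tens 1 (antipode b1)) (tmul (tens b2 1) (tens 1 b3))).
by rewrite !tmul_tens !mul1r mulr1.
Qed.

(** The algebra R (x) B is represented by any algebra [T] with homomorphisms [j1]
    and [j2] from [R] and [B], where the values of [j2] are central. *)
Section Generators.
Variables (K : comNzRingType) (B : gradedHopfType K) (R : algType K) (T : kalg K).
Hypotheses (Bu : ungraded B) (Bc : graded_commutative B).
Notation BA := (plain_alg B).
Notation BB := (tensor_alg B B).
Notation RA := (plain_alg R).

Variables (j1 : {linear RA -> T}) (j2 : {linear BA -> T}).
Hypotheses (hj1 : alg_hom j1) (hj2 : alg_hom j2) (j2C : forall b u, j2 b ** u = u ** j2 b).

Definition inl_map (x : {linear B -> R}) : {linear B -> T} := j1 \o x.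

Let j2M (x y : B) : j2 (x * y) = j2 x ** j2 y. Proof. exact: hj2.2. Qed.
Let j1M (x y : R) : j1 (x * y) = j1 x ** j1 y. Proof. exact: hj1.2. Qed.

(** The map u (x) v |-> r_u (x) v is not multiplicative, but it is B-linear, which
    is what is needed to transport [adjoint_kappa] to [T]. *)
Lemma pairing_lift (r : {linear B -> R}) : exists theta : {linear BB -> T},
  [/\ forall u v, theta (tens u v) = j1 (r u) ** j2 v,
      forall w (v : B), theta (w ** inr_alg B v) = theta w ** j2 v
    & forall w (v : B), theta (inr_alg B v ** w) = j2 v ** theta w].
Proof.
have [|h hE] := @tensor_lift_ex K B B T (fun u v => j1 (r u) ** j2 v); first by lin.
have hr w (v : B) : h (w ** inr_alg B v) = h w ** j2 v.
  have -> : w ** inr_alg B v = tsum w (fun m n => (tens m n : BB) ** inr_alg B v).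
    by rewrite -(ktsuml (C := BB)) {1}(hrepP w).2.
  have -> : h w ** j2 v = tsum w (fun m n => h (tens m n) ** j2 v).
    by rewrite -ktsuml {1}(hrepP w).2 linear_tsum.
  rewrite linear_tsum; apply: eq_tsum => m n.
  by rewrite -[_ ** inr_alg B v]/(tmul _ _) tmul_tens !hE mulr1 j2M kmulA.
exists h; split=> // w v; rewrite j2C -hr; congr (h _); exact: tensor_algC.
Qed.

Lemma pairing_lift_conj (theta : {linear BB -> T}) (f : {linear B -> BB}) :
  (forall w (v : B), theta (w ** inr_alg B v) = theta w ** j2 v) ->
  (forall w (v : B), theta (inr_alg B v ** w) = j2 v ** theta w) ->
  post j2 (id_map B) \conv post theta f \conv post j2 (antipode_map B)
  = post theta (post (inr_alg B) (id_map B) \conv f \conv post (inr_alg B) (antipode_map B)).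
Proof.
move=> hr hl; apply: linear_ext => b; rewrite -convA convE.
rewrite -[RHS]/(theta _) -convA convE linear_tsum; apply: eq_tsum => b1 b'.
rewrite hl; congr (_ ** _); rewrite !convE linear_tsum; apply: eq_tsum => b2 b3.
by rewrite hr.
Qed.

Variables (t : B) (tl : trace_like t).
Variable coactT : {linear RA -> T}.
Hypothesis hcoact : alg_hom coactT.

(** The coaction on the generators x_b of the representation algebra. *)
Definition adjoint_covariant (x : {linear B -> R}) := forall b, coactT (x b) =
  sw3 b (fun b1 b2 b3 => j1 (x b2) ** j2 (antipode b1 * b3)).

Lemma adjoint_covariant_conv (x : {linear B -> R}) : adjoint_covariant x -> post coactT x =
  post j2 (antipode_map B) \conv inl_map x \conv post j2 (id_map B).
Proof.
move=> xc; apply: linear_ext => b; rewrite -convA convE -[LHS]/(coactT (x b)) xc.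
apply: eq_tsum => b1 b'; rewrite convE ktsumr; apply: eq_tsum => b2 b3.
rewrite j2M kmulA -(j2C (antipode b1)) -kmulA.
by [].
Qed.

(** As a function of c, this is (u . c^(3)) y_{c^(2)} (x) s(c^(1)) c^(4). *)
Definition right_factor (y : {linear B -> R}) (u : B) : {linear B -> T} :=
  post j2 (antipode_map B) \conv inl_map y
  \conv scalar_map (trace_form t u) \conv post j2 (id_map B).

(** The common value of the two sides of the equivariance condition for
    [bracket_core]: in Sweedler notation
    (b^(2) . c^(3)) r_{b^(1) s(b^(3))} x_{b^(4)} y_{c^(2)} (x) s(c^(1)) c^(4). *)
Definition core_coaction r x y b c : T := tsum (comul b) (fun b' b'' =>
  sw3 b' (fun b1 b2 b3 => j1 (r (b1 * antipode b3)) ** inl_map x b'' ** right_factor y b2 c)).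

Lemma kappa_coadjoint d b :
  kappa t d b = sw3 b (fun b1 b2 b3 => trace_form t b2 d *: (b1 * antipode b3)).
Proof.
rewrite kappa_sw3 //; apply: eq_tsum => b1 b'; apply: eq_tsum => b2 b3.
by rewrite (trace_formC tl) ungraded_mulC.
Qed.

(** Here kappa is expanded in b, which makes it linear in the single factor of c
    that is paired with b^(2). *)
Lemma equiv_left_core r x y b c :
  sw3 c (fun c1 c2 c3 => j1 (bracket_core t r x y b c2) ** j2 (antipode c1 * c3))
  = core_coaction r x y b c.
Proof.
pose W b1 b3 b'' : T := j1 (r (b1 * antipode b3)) ** inl_map x b''.
have e c2 : j1 (bracket_core t r x y b c2) = tsum (comul b) (fun b' b'' =>
  sw3 b' (fun b1 b2 b3 => W b1 b3 b'' ** (inl_map y \conv scalar_map (trace_form t b2)) c2)).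
  rewrite /bracket_core linear_tsum; apply: eq_tsum => b' b''.
  transitivity (tsum (comul c2) (fun c' c'' => sw3 b' (fun b1 b2 b3 =>
      trace_form t b2 c'' *: (W b1 b3 b'' ** inl_map y c')))).
    rewrite linear_tsum; apply: eq_tsum => c' c''.
    have lr : linear (fun z : B => j1 (r z * x b'' * y c')) by lin.
    rewrite kappa_coadjoint -(tsum_fun _ _ lr); apply: eq_tsum => b1 b0.
    rewrite -(tsum_fun _ _ lr); apply: eq_tsum => b2 b3.
    by rewrite (linear_scale _ _ lr) !j1M.
  rewrite /sw3 /sw2; apply: (etrans (exchange_tsum _ _ _)); apply: eq_tsum => b1 b0.
  apply: (etrans (exchange_tsum _ _ _)); apply: eq_tsum => b2 b3.
  rewrite convE ktsumr; apply: eq_tsum => c' c''.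
  by rewrite kscaleAr kmulr1 kscaleAr.
transitivity (sw3 c (fun c1 c2 c3 => tsum (comul b) (fun b' b'' =>
  sw3 b' (fun b1 b2 b3 => W b1 b3 b'' ** (j2 (antipode c1) **
    ((inl_map y \conv scalar_map (trace_form t b2)) c2 ** j2 c3)))))).
  apply: eq_tsum => c1 c0; apply: eq_tsum => c2 c3.
  rewrite j2M e !ktsuml; apply: eq_tsum => b' b''.
  rewrite ktsuml; apply: eq_tsum => b1 b0; rewrite ktsuml; apply: eq_tsum => b2 b3.
  by move: (W b1 b3 b'') => w; rewrite !kmulA -(kmulA w (j2 _)) j2C !kmulA.
rewrite /core_coaction /sw3 /sw2.
transitivity (tsum (comul b) (fun b' b'' => sw3 c (fun c1 c2 c3 =>
  sw3 b' (fun b1 b2 b3 => W b1 b3 b'' ** (j2 (antipode c1) **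
    ((inl_map y \conv scalar_map (trace_form t b2)) c2 ** j2 c3)))))).
  by rewrite exchange_tsum; apply: eq_tsum => c1 c0; apply: exchange_tsum.
apply: eq_tsum => b' b''; rewrite exchange_sw3.
apply: eq_tsum => b1 b0; apply: eq_tsum => b2 b3.
rewrite /right_factor -2!convA [inl_map y \conv (_ \conv _)]convA convE ktsumr.
by apply: eq_tsum => c1 c0; rewrite convE !ktsumr.
Qed.

(** The factors coming from the coactions on r and x cancel by [adjoint_kappa],
    which leaves kappa(b^(2), c'') in the factor B. Expanded in its second
    argument by [kappa_dual], it starts with an antipode, and this cancels the last
    factor of the coaction on y. *)
Lemma equiv_right_core r x y b c :
  adjoint_covariant r -> adjoint_covariant x -> adjoint_covariant y ->
  sw3 b (fun b1 b2 b3 => coactT (bracket_core t r x y b2 c) **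
    j2 (antipode (antipode b1 * b3))) = core_coaction r x y b c.
Proof.
move=> rc xc yc; have hS := alg_hom_antipode Bu Bc; have hc := hcoact.
have [theta [thE thr thl]] := pairing_lift r.
(* [H d], [DX] and [DY] are the coactions on the three factors, as functions of
   b', b'' and c'. *)
pose H d := post theta (post (adjoint_coaction B) (kappa t d)).
have HE d u : coactT (r (kappa t d u)) = H d u.
  rewrite -[RHS]/(theta (adjoint_coaction B (kappa t d u))) rc adjoint_sw3.
  rewrite linear_tsum; apply: eq_tsum => b1 b'; rewrite linear_tsum; apply: eq_tsum => b2 b3.
  by rewrite thE.
pose X := inl_map x.
pose DX : {linear B -> T} := post j2 (antipode_map B) \conv X \conv post j2 (id_map B).
have DXE u : coactT (x u) = DX u by rewrite /DX /X -(adjoint_covariant_conv xc).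
pose DY : {linear B -> T} := post j2 (antipode_map B) \conv inl_map y \conv post j2 (id_map B).
have DYE u : coactT (y u) = DY u by rewrite /DY -(adjoint_covariant_conv yc).
have e1 u : coactT (bracket_core t r x y u c) = tsum (comul c) (fun c' d =>
    (H d \conv DX) u ** DY c').
  rewrite /bracket_core linear_tsum.
  transitivity (tsum (comul u) (fun u1 u2 => tsum (comul c) (fun c' d =>
    H d u1 ** DX u2 ** DY c'))).
    apply: eq_tsum => u1 u2; rewrite linear_tsum; apply: eq_tsum => c' d.
    by rewrite -HE -DXE -DYE -!hc.2.
  by rewrite exchange_tsum; apply: eq_tsum => c' d; rewrite convE ktsuml.
pose E d := post (inl_alg B) (id_map B) \conv post (inr_alg B) (kappa t d)
  \conv post (inl_alg B) (antipode_map B).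
transitivity (tsum (comul c) (fun c' d => (post theta (E d) \conv X) b ** DY c')).
  transitivity (tsum (comul c) (fun c' d =>
      (post j2 (id_map B) \conv ((H d \conv DX) \conv post j2 (antipode_map B))) b ** DY c')).
    transitivity (tsum (comul c) (fun c' d => sw3 b (fun b1 b2 b3 =>
      j2 b1 ** ((H d \conv DX) b2 ** j2 (antipode b3)) ** DY c'))).
      rewrite /sw3 /sw2; apply: (etrans _ (esym (exchange_tsum _ _ _))); apply: eq_tsum => b1 b0.
      apply: (etrans _ (esym (exchange_tsum _ _ _))); apply: eq_tsum => b2 b3.
      rewrite antipodeM // antipode_involutive // j2M e1 ktsuml; apply: eq_tsum => c' d.
      rewrite -j2M -kmulA -j2C j2M !kmulA; congr (_ ** _ ** _); exact: esym (j2C _ _).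
    apply: eq_tsum => c' d; rewrite convE ktsuml; apply: eq_tsum => b1 b0.
    by rewrite convE ktsumr ktsuml.
  apply: eq_tsum => c' d; congr (_ ** _).
  suff -> : post j2 (id_map B) \conv (H d \conv DX \conv post j2 (antipode_map B)) =
      post theta (E d) \conv X by [].
  rewrite /DX !convA (conv_cancel _ (post_antipoder hj2)); congr (_ \conv _).
  by rewrite pairing_lift_conj // adjoint_kappa.
transitivity (tsum (comul b) (fun b' b'' => sw3 b' (fun b1 b2 b3 => tsum (comul c) (fun c' d =>
  j1 (r (b1 * antipode b3)) ** j2 (kappa t d b2) ** X b'' ** DY c')))).
  have thEd d u : theta (E d u) = sw3 u (fun b1 b2 b3 =>
      j1 (r (b1 * antipode b3)) ** j2 (kappa t d b2)).
    rewrite /E -convA convE linear_tsum; apply: eq_tsum => b1 b0.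
    rewrite convE ktsumr linear_tsum; apply: eq_tsum => b2 b3.
    rewrite -thE; congr (theta _).
    rewrite -[LHS]/(tmul (tens b1 1) (tmul (tens 1 (kappa t d b2)) (tens (antipode b3) 1))).
    by rewrite !tmul_tens !mul1r mulr1.
  transitivity (tsum (comul c) (fun c' d => tsum (comul b) (fun b' b'' =>
    sw3 b' (fun b1 b2 b3 => j1 (r (b1 * antipode b3)) ** j2 (kappa t d b2) ** X b'' ** DY c')))).
    apply: eq_tsum => c' d; rewrite convE ktsuml; apply: eq_tsum => b' b''.
    rewrite -[post theta _ _]/(theta (E d b')) thEd !ktsuml; apply: eq_tsum => b1 b0.
    by rewrite !ktsuml.
  rewrite exchange_tsum; apply: eq_tsum => b' b''; rewrite /sw3 /sw2 exchange_tsum.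
  by apply: eq_tsum => b1 b0; rewrite exchange_tsum.
apply: eq_tsum => b' b''; apply: eq_tsum => b1 b0; apply: eq_tsum => b2 b3.
transitivity (j1 (r (b1 * antipode b3)) ** X b'' ** (DY \conv (post j2
   (antipode_map B \conv scalar_map (trace_form t b2) \conv id_map B))) c).
  rewrite convE ktsumr; apply: eq_tsum => c' d.
  rewrite -[post j2 _ d]/(j2 ((antipode_map B \conv scalar_map (trace_form t b2)
    \conv id_map B) d)) -kappa_dual //.
  by rewrite -(j2C _ (DY c')) !kmulA -(kmulA _ (X b'') (j2 _)) -(j2C _ (X b'')) !kmulA.
congr (_ ** _).
by rewrite !post_conv // post_scalar_map // /DY !convA (conv_cancel _ (post_antipoder hj2)).
Qed.

End Generators.

(** * Equivariance and the Leibniz rules *)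

(** Coassociativity turns (m^l)^l (x) (m^l)^r s(m^r) into m^l (x) (m^r)' s((m^r)''),
    which is m (x) 1. *)
Lemma comodule_antipode (K : comNzRingType) (B : gradedHopfType K) (M : degModType K)
    (T : kalg K) (j1 : {linear M -> T}) (j2 : {linear plain_alg B -> T})
    (coact : M -> tensor M B) (x : M) : alg_hom j2 -> comodule coact ->
  tsum (coact x) (fun l r => tsum (coact l) (fun l' r' => j1 l' ** j2 r') ** j2 (antipode r))
  = j1 x.
Proof.
move=> hj2 [cl cA c1].
pose g (w : tensor B B) : B := tsum w (fun r1 r2 => r1 * antipode r2).
have gl : linear g by rewrite /g; lin.
have [|h hE] := @tensor_lift_ex K M (tensor B B) T (fun l w => j1 l ** j2 (g w)).
  by split=> u /=; [apply: lin_kmulr; apply: (@lin_app _ _ _ _ j2 g)|lin].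
have e1 : h (tsum (coact x) (fun l r => tsum (coact l) (fun l' r' => tens l' (tens r' r)))) =
    tsum (coact x) (fun l r => tsum (coact l) (fun l' r' => j1 l' ** j2 r') ** j2 (antipode r)).
  rewrite linear_tsum; apply: eq_tsum => l r; rewrite linear_tsum ktsuml.
  apply: eq_tsum => l' r'; rewrite hE /g tsum_tens; last by lin.
  by rewrite (hj2.2 r') kmulA.
rewrite -e1 cA linear_tsum -[in RHS](c1 x) linear_tsum; apply: eq_tsum => l r.
rewrite hE /g antipoder linearZ_LR -[X in _ ** (_ *: X)]/(j2 (kone (k := plain_alg B))).
by rewrite hj2.1 kscaleAr kmulr1 linearZ_LR.
Qed.

(** An induction principle saying that [G] generates [R] as an algebra, through
    products and combinations of homogeneous elements. It is restricted to these
    because the signs in the Leibniz rules require homogeneous arguments. *)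
Definition homogeneously_generated (K : comNzRingType) (R : degAlgType K) (G : R -> Prop) : Prop :=
  forall P : int -> R -> Prop,
    (forall p, P p 0) -> P 0 1 -> (forall p u, G u -> hpart p u -> P p u) ->
    (forall p a u v, hpart p u -> P p u -> hpart p v -> P p v -> P p (a *: u + v)) ->
    (forall p q u v, hpart p u -> P p u -> hpart q v -> P q v -> P (p + q) (u * v)) ->
  forall p u, hpart p u -> P p u.

Section Leibniz.
Variables (K : comNzRingType) (B : gradedHopfType K) (R : degAlgType K) (T : kalg K).
Hypotheses (Bu : ungraded B) (Bc : graded_commutative B).
Notation BA := (plain_alg B).
Notation RA := (plain_alg R).
Variables (j1 : {linear RA -> T}) (j2 : {linear BA -> T}).
Hypotheses (hj1 : alg_hom j1) (hj2 : alg_hom j2) (j2C : forall b u, j2 b ** u = u ** j2 b).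
Variables (coact : R -> tensor R B) (coactT : {linear RA -> T}).
Hypotheses (coact_hom : graded_alg_hom coact) (coact_comod : comodule coact)
  (hcoact : alg_hom coactT)
  (coactTE : forall m, coactT m = tsum (coact m) (fun l r => j1 l ** j2 r)).
Variables (n : int) (br : R -> R -> R).
Hypothesis br_bracket : graded_bracket n br.

(** As B is concentrated in degree 0, the components y^l of y have the degree of
    y, so that rules for homogeneous elements apply to y^l. *)
Lemma coact_hpart_ext q y (F G : R -> B -> T) : hpart q y ->
  bilinear_map F -> bilinear_map G -> (forall l r, hpart q l -> F l r = G l r) ->
  tsum (coact y) F = tsum (coact y) G.
Proof.
move=> yq Fb Gb FG; have [_ /(_ _ _ yq)[s sh ->] _ _] := coact_hom.
have e (H : R -> B -> T) : bilinear_map H ->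
    tsum (\sum_(w <- s) tens w.1 w.2) H = \sum_(w <- s) H w.1 w.2.
  move=> Hb; have [h hE] := tensor_lift_ex Hb.
  have tE u : tsum u H = h u by rewrite tsum_lift; apply: eq_tsum => l r; rewrite hE.
  by rewrite tE linear_sum; apply: eq_bigr => w _; rewrite hE.
rewrite !e // !big_seq; apply: eq_bigr => w /sh[p [q' [w1 w2 pq]]].
have [->|w20] := eqVneq w.2 0.
  have [Fr _] := Fb; have [Gr _] := Gb.
  by rewrite -(scale0r (0 : B)) (linear_scale _ _ (Fr _)) (linear_scale _ _ (Gr _)) !scale0r.
apply: FG; suff <- : p = q by [].
have [q'0|q'0] := eqVneq q' 0; first by rewrite -pq q'0 addr0.
by have := ungraded_hpart Bu q'0 w2; move/eqP: w20.
Qed.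

Lemma coact_mul_sum (P : lmodType K) (F : R -> B -> P) x y : bilinear_map F ->
  tsum (coact (x * y)) F = tsum (coact x) (fun l r => tsum (coact y) (fun l' r' =>
    F (l * l') (r * r'))).
Proof.
move=> Fb; have [_ _ _ ->] := coact_hom; rewrite tensor_mulE // /tmul tsum_tsum //.
apply: eq_tsum => l r; rewrite tsum_tsum //; apply: eq_tsum => l' r'.
by rewrite tsum_tens.
Qed.

(** The two sides of the equivariance condition, as elements of [T]. *)
Definition equiv_left m1 m2 : T := tsum (coact m2) (fun l r => j1 (br m1 l) ** j2 r).
Definition equiv_right m1 m2 : T :=
  tsum (coact m1) (fun l r => coactT (br l m2) ** j2 (antipode r)).

Let br_linr x : linear (br x). Proof. by have [[h _] _ _ _] := br_bracket; apply: h. Qed.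
Let br_linl y : linear (br^~ y). Proof. by have [[_ h] _ _ _] := br_bracket; apply: h. Qed.

Lemma equiv_left_lin1 m2 : linear (equiv_left^~ m2).
Proof. by have hr := br_linr; have hl := br_linl; rewrite /equiv_left; lin. Qed.
Lemma equiv_right_lin2 m1 : linear (equiv_right m1).
Proof. by have hr := br_linr; have hl := br_linl; rewrite /equiv_right; lin. Qed.
Lemma equiv_left_lin2 m1 : linear (equiv_left m1).
Proof.
have [cl _ _ _] := coact_hom; have hr := br_linr; have hl := br_linl.
by rewrite /equiv_left; lin.
Qed.
Lemma equiv_right_lin1 m2 : linear (equiv_right^~ m2).
Proof.
have [cl _ _ _] := coact_hom; have hr := br_linr; have hl := br_linl.
by rewrite /equiv_right; lin.
Qed.

Let kmul_j2 u v r w : u ** v ** (j2 r ** w) = u ** j2 r ** (v ** w).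
Proof. by rewrite !kmulA -(kmulA u v) -j2C kmulA. Qed.

Let j1M x y : j1 (x * y) = j1 x ** j1 y. Proof. exact: hj1.2. Qed.
Let j2M x y : j2 (x * y) = j2 x ** j2 y. Proof. exact: hj2.2. Qed.
Let coactTM x y : coactT (x * y) = coactT x ** coactT y. Proof. exact: hcoact.2. Qed.

Lemma equiv_left_mulr p q m y z : hpart p m -> hpart q y ->
  equiv_left m (y * z) =
    equiv_left m y ** coactT z + ksgn ((p + n) * q) *: (coactT y ** equiv_left m z).
Proof.
move=> mp yq; have [_ _ brM _] := br_bracket; have hr := br_linr; have hl := br_linl.
rewrite /equiv_left coact_mul_sum; last by lin.
transitivity (tsum (coact y) (fun l r => j1 (br m l) ** j2 r ** coactT z +
    ksgn ((p + n) * q) *: (j1 l ** j2 r ** equiv_left m z))); last first.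
  by rewrite -tsumD ktsuml -tsumZ (coactTE y) ktsuml.
apply: (coact_hpart_ext yq); [by lin|by lin|].
move=> l r lq; rewrite coactTE /equiv_left !ktsumr tsumZ tsumD; apply: eq_tsum => l' r'.
rewrite (brM p q) // linearD linearZ_LR !j1M j2M kmulDl kscaleAl.
by rewrite !kmul_j2.
Qed.

Lemma equiv_right_mulr p q m y z : hpart p m -> hpart q y ->
  equiv_right m (y * z) =
    equiv_right m y ** coactT z + ksgn ((p + n) * q) *: (coactT y ** equiv_right m z).
Proof.
move=> mp yq; have [_ _ brM _] := br_bracket; have hr := br_linr; have hl := br_linl.
rewrite /equiv_right ktsuml ktsumr tsumZ tsumD; apply: (coact_hpart_ext mp); [by lin|by lin|].
move=> l r lp; rewrite (brM p q) // linearD linearZ_LR !coactTM kmulDl kscaleAl.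
by rewrite -!kmulA j2C.
Qed.

Lemma equiv_left_mull q r x y z : hpart q y -> hpart r z ->
  equiv_left (x * y) z = j1 x ** equiv_left y z + ksgn (q * (r + n)) *: (equiv_left x z ** j1 y).
Proof.
move=> yq zr; have [_ _ _ brM] := br_bracket; have hr := br_linr; have hl := br_linl.
rewrite /equiv_left ktsuml ktsumr tsumZ tsumD; apply: (coact_hpart_ext zr); [by lin|by lin|].
move=> l s lr; rewrite (brM q r) // linearD linearZ_LR !j1M kmulDl kscaleAl.
by rewrite -!kmulA j2C.
Qed.

Lemma coact_antipode x : tsum (coact x) (fun l r => coactT l ** j2 (antipode r)) = j1 x.
Proof.
rewrite -(comodule_antipode j1 x hj2 coact_comod); apply: eq_tsum => l r.
by rewrite coactTE.
Qed.

(** The two antipodes s(x^r) and s(y^r) each find the coaction of their own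
    argument to cancel with, which leaves x (x) 1 and y (x) 1. *)
Lemma equiv_right_mull q r x y z : hpart q y -> hpart r z ->
  equiv_right (x * y) z = j1 x ** equiv_right y z + ksgn (q * (r + n)) *: (equiv_right x z ** j1 y).
Proof.
move=> yq zr; have [_ _ _ brM] := br_bracket; have hr := br_linr; have hl := br_linl.
rewrite -(coact_antipode x) -(coact_antipode y) ktsuml.
rewrite {1}/equiv_right coact_mul_sum; last by lin.
rewrite [equiv_right x z]/equiv_right ktsuml tsumZ tsumD; apply: eq_tsum => l s.
rewrite /equiv_right !ktsumr tsumZ tsumD; apply: (coact_hpart_ext yq); [by lin|by lin|].
move=> l' s' lq; rewrite (brM q r) // linearD linearZ_LR !coactTM antipodeM // j2M kmulDl kscaleAl.
by rewrite !kmul_j2.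
Qed.

(** Leibniz for 1 * 1 gives a = a + a, with sign +1 as 1 has degree 0. *)
Lemma br_1r p m : hpart p m -> br m 1 = 0.
Proof.
have [_ _ brM _] := br_bracket; move=> mp.
have := brM p 0 m 1 1 mp (@hpart_one _ _); rewrite !mulr1 mulr0 scale1r mul1r => /eqP.
by rewrite -subr_eq0 opprD addrA subrr sub0r oppr_eq0 => /eqP.
Qed.

Lemma br_1l p m : hpart p m -> br 1 m = 0.
Proof.
have [_ _ _ brM] := br_bracket; move=> mp.
have := brM 0 p 1 1 m (@hpart_one _ _) mp; rewrite !mul1r mul0r scale1r mulr1 => /eqP.
by rewrite -subr_eq0 opprD addrA subrr sub0r oppr_eq0 => /eqP.
Qed.

Lemma equiv_1r p m : hpart p m -> equiv_left m 1 = equiv_right m 1.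
Proof.
move=> mp; have [_ _ c1 _] := coact_hom; have hr := br_linr; have hl := br_linl.
rewrite /equiv_left c1 tsum_tens; last by lin.
rewrite (br_1r mp) linear0 kmul0 -(tsum0 T (coact m)).
apply: (coact_hpart_ext mp); [by split=> ? ? ? ?; rewrite scaler0 addr0|by lin|].
by move=> l r /br_1r ->; rewrite linear0 kmul0.
Qed.

Lemma equiv_1l p m : hpart p m -> equiv_left 1 m = equiv_right 1 m.
Proof.
move=> mp; have [_ _ c1 _] := coact_hom; have hr := br_linr; have hl := br_linl.
rewrite /equiv_right c1 tsum_tens; last by lin.
rewrite (br_1l mp) linear0 kmul0 -(tsum0 T (coact m)).
apply: (coact_hpart_ext mp); [by lin|by split=> ? ? ? ?; rewrite scaler0 addr0|].
by move=> l r /br_1l ->; rewrite linear0 kmul0.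
Qed.

Section Induction.
Variable G : R -> Prop.
Hypothesis RG : homogeneously_generated G.

Lemma equiv_induction : (forall u v, G u -> G v -> equiv_left u v = equiv_right u v) ->
  forall u v, equiv_left u v = equiv_right u v.
Proof.
move=> GE.
have l0 (V : lmodType K) (f : R -> V) : linear f -> f 0 = 0.
  by move=> fl; rewrite -(scale0r (0 : R)) (linear_scale _ _ fl) scale0r.
have E1 p u q v : G u -> hpart p u -> hpart q v -> equiv_left u v = equiv_right u v.
  move=> Gu up; move: q v; apply: RG.
  - by move=> _; rewrite (l0 _ _ (equiv_left_lin2 u)) (l0 _ _ (equiv_right_lin2 u)).
  - exact: equiv_1r up.
  - by move=> q v Gv _; exact: GE.
  - by move=> q a v w _ Ev _ Ew; rewrite equiv_left_lin2 equiv_right_lin2 Ev Ew.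
  by move=> q r v w vq Ev _ Ew; rewrite (equiv_left_mulr _ up vq) (equiv_right_mulr _ up vq) Ev Ew.
have E2 p u q v : hpart p u -> hpart q v -> equiv_left u v = equiv_right u v.
  move=> up vq; move: p u up; apply: RG.
  - by move=> _; rewrite (l0 _ _ (equiv_left_lin1 v)) (l0 _ _ (equiv_right_lin1 v)).
  - exact: equiv_1l vq.
  - by move=> p u Gu up; exact: E1 Gu up vq.
  - move=> p a u w _ Eu _ Ew.
    by rewrite (equiv_left_lin1 v a u w) (equiv_right_lin1 v a u w) Eu Ew.
  by move=> p r u w _ Eu wr Ew; rewrite (equiv_left_mull _ wr vq) (equiv_right_mull _ wr vq) Eu Ew.
have sumE (V : lmodType K) (f : R -> V) s : linear f -> f (\sum_(w <- s) w) = \sum_(w <- s) f w.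
  move=> fl; elim: s => [|w s IH]; first by rewrite !big_nil l0.
  by rewrite !big_cons -[w]scale1r fl !scale1r IH.
have E3 p u v : hpart p u -> equiv_left u v = equiv_right u v.
  move=> up; have [sv vh ->] := hpart_span v.
  rewrite (sumE _ _ sv (equiv_left_lin2 u)) (sumE _ _ sv (equiv_right_lin2 u)) !big_seq.
  by apply: eq_bigr => w /vh[q vq]; exact: E2 up vq.
move=> u v; have [su uh ->] := hpart_span u.
rewrite (sumE _ _ su (equiv_left_lin1 v)) (sumE _ _ su (equiv_right_lin1 v)) !big_seq.
by apply: eq_bigr => w /uh[p up]; exact: E3 up.
Qed.
End Induction.

Variables (t : B) (tl : trace_like t).
Variables (A : gradedBialgType K) (rp : A -> {linear B -> R}) (rho : A -> A -> A) (s : A -> A -> K).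
Hypothesis coact_rp : forall x b, coact (rp x b) =
  sw3 b (fun b1 b2 b3 => tens (rp x b2) (antipode b1 * b3)).
Hypothesis br_rp : forall x y b c, br (rp x b) (rp y c) =
  sw2 x (fun x1 x2 => sw2 y (fun y1 y2 =>
    s x2 y1 *: bracket_core t (rp (rho x1 y1)) (rp x2) (rp y2) b c)).

(** The sum over the components of x and y, with the signs [s], is the same on both
    sides. *)
Lemma equiv_generators x b y c : equiv_left (rp x b) (rp y c) = equiv_right (rp x b) (rp y c).
Proof.
have hr := br_linr; have hl := br_linl.
have ac z : adjoint_covariant j1 j2 coactT (rp z).
  move=> d; rewrite coactTE coact_rp tsum_tsum; last by lin.
  apply: eq_tsum => d1 d'; rewrite tsum_tsum; last by lin.
  by apply: eq_tsum => d2 d3; rewrite tsum_tens; last by lin.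
transitivity (sw2 x (fun x1 x2 => sw2 y (fun y1 y2 => s x2 y1 *:
    core_coaction j1 j2 t (rp (rho x1 y1)) (rp x2) (rp y2) b c))).
  rewrite /equiv_left coact_rp.
  transitivity (sw3 c (fun c1 c2 c3 => j1 (br (rp x b) (rp y c2)) ** j2 (antipode c1 * c3))).
    rewrite tsum_tsum; last by lin.
    apply: eq_tsum => c1 c0; rewrite tsum_tsum; last by lin.
    by apply: eq_tsum => c2 c3; rewrite tsum_tens; last by lin.
  transitivity (sw3 c (fun c1 c2 c3 => sw2 x (fun x1 x2 => sw2 y (fun y1 y2 => s x2 y1 *:
     (j1 (bracket_core t (rp (rho x1 y1)) (rp x2) (rp y2) b c2) ** j2 (antipode c1 * c3)))))).
    apply: eq_tsum => c1 c0; apply: eq_tsum => c2 c3.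
    rewrite br_rp linear_tsum ktsuml; apply: eq_tsum => x1 x2.
    rewrite linear_tsum ktsuml; apply: eq_tsum => y1 y2.
    by rewrite linearZ_LR kscaleAl.
  rewrite exchange_sw32; apply: eq_tsum => x1 x2; rewrite exchange_sw32; apply: eq_tsum => y1 y2.
  rewrite -(equiv_left_core (T := T)) // /sw3 /sw2 tsumZ; apply: eq_tsum => c1 c0.
  by rewrite tsumZ.
transitivity (sw3 b (fun b1 b2 b3 =>
    coactT (br (rp x b2) (rp y c)) ** j2 (antipode (antipode b1 * b3)))); last first.
  rewrite /equiv_right coact_rp tsum_tsum; last by lin.
  apply: eq_tsum => b1 b0; rewrite tsum_tsum; last by lin.
  by apply: eq_tsum => b2 b3; rewrite tsum_tens; last by lin.
transitivity (sw3 b (fun b1 b2 b3 => sw2 x (fun x1 x2 => sw2 y (fun y1 y2 => s x2 y1 *: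
   (coactT (bracket_core t (rp (rho x1 y1)) (rp x2) (rp y2) b2 c) **
    j2 (antipode (antipode b1 * b3))))))).
  rewrite exchange_sw32; apply: eq_tsum => x1 x2; rewrite exchange_sw32; apply: eq_tsum => y1 y2.
  rewrite -(equiv_right_core Bu Bc hj2 j2C tl hcoact) // /sw3 /sw2 tsumZ.
  by apply: eq_tsum => b1 b0; rewrite tsumZ.
apply: eq_tsum => b1 b0; apply: eq_tsum => b2 b3.
rewrite br_rp linear_tsum ktsuml; apply: eq_tsum => x1 x2.
rewrite linear_tsum ktsuml; apply: eq_tsum => y1 y2.
by rewrite linearZ_LR kscaleAl.
Qed.
End Leibniz.

Lemma equivariant_of_generators (K : comNzRingType) (A B : gradedHopfType K) (R : degAlgType K)
    (n : int) (br : R -> R -> R) (coact : R -> tensor R B) (t : B)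
    (rp : A -> {linear B -> R}) (rho : A -> A -> A) (s : A -> A -> K) :
  ungraded B -> graded_commutative B -> trace_like t -> graded_bracket n br ->
  graded_alg_hom coact -> comodule coact ->
  (forall x b, coact (rp x b) = sw3 b (fun b1 b2 b3 => tens (rp x b2) (antipode b1 * b3))) ->
  (forall x y b c, br (rp x b) (rp y c) = sw2 x (fun x1 x2 => sw2 y (fun y1 y2 =>
     s x2 y1 *: bracket_core t (rp (rho x1 y1)) (rp x2) (rp y2) b c))) ->
  homogeneously_generated (fun u => exists x b, u = rp x b) ->
  equivariant coact coact br.
Proof.
move=> Bu Bc tl brb ch cc crp brrp Rgen.
pose T := tensor_alg R B.
pose j1 : {linear plain_alg R -> T} := @tinl K R B.
pose j2 : {linear plain_alg B -> T} := @tinr K R B.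
have hj1 : alg_hom j1 by split=> // x y; exact: tinlM.
have hj2 : alg_hom j2 by split=> // x y; exact: tinrM.
have j2C b u : j2 b ** u = u ** j2 b by apply: tinr_central; exact: ungraded_mulC.
have [cl _ c1 cM] := ch.
pose coactT : {linear plain_alg R -> T} :=
  HB.pack coact (GRing.isLinear.Build K R (tensor R B) *:%R coact cl).
have hc : alg_hom coactT.
  by split; [exact: c1|move=> x y; rewrite -[RHS]tensor_mulE //; exact: cM].
have tj u b : tens u b = j1 u ** j2 b by exact: tensE.
have cE m : coactT m = tsum (coact m) (fun l r => j1 l ** j2 r).
  by rewrite -[LHS]/(coact m) {1}(hrepP (coact m)).2; apply: eq_tsum => l r; exact: tj.
have main := equiv_induction Bu Bc hj1 hj2 j2C ch cc hc cE brb Rgen.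
have gen := equiv_generators Bu Bc hj1 hj2 j2C hc cE brb tl crp brrp.
have e : forall u v, equiv_left j1 j2 coact br u v = equiv_right j2 coact coactT br u v.
  by apply: main => _ _ [x [b ->]] [y [c ->]]; exact: gen.
move=> m1 m2; apply: (etrans _ (etrans (e m1 m2) _)).
  by apply: eq_tsum => l r; exact: tj.
apply: eq_tsum => l r; rewrite cE ktsuml; apply: eq_tsum => l' r'.
by rewrite tj -kmulA -hj2.2.
Qed.

Theorem theorem7p3 (K : comNzRingType) (A B : gradedHopfType K) (n : int)
    (rho : A -> A -> A) (t : B) (br : repalg A B -> repalg A B -> repalg A B) :
  cocommutative A ->
  fox_pairing n rho ->
  fox_antisymmetric n rho ->
  ungraded B ->
  graded_commutative B ->
  trace_like t ->
  graded_bracket n br ->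
  (forall (x y : A) (b c : B),
     br (rep x b) (rep y c) =
     sw2 x (fun x1 x2 => sw2 y (fun y1 y2 =>
     sw4 b (fun b1 b2 b3 b4 => sw2 c (fun c1 c2 =>
       (ksgn (deg x2 * (deg y1 + n)) * trace_form t c2 b2) *:
         (rep (rho x1 y1) (antipode b3 * b1) * rep x2 b4 * rep y2 c1)))))) ->
  (forall (x y : A) (b c : B),
     br (rep x b) (rep y c) =
     sw2 x (fun x1 x2 => sw2 y (fun y1 y2 =>
     sw4 t (fun t1 t2 t3 t4 => sw2 b (fun b1 b2 => sw2 c (fun c1 c2 =>
       (ksgn (deg x2 * (deg y1 + n)) * trace_form t b1 t2 * trace_form t c2 t4) *:
         (rep (rho x1 y1) (antipode t1 * t3) * rep x2 b2 * rep y2 c1)))))))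
  /\
  (forall coact : repalg A B -> tensor (repalg A B) B,
     graded_alg_hom coact ->
     comodule coact ->
     (forall (x : A) (b : B),
        coact (rep x b) =
        sw3 b (fun b1 b2 b3 => tens (rep x b2) (antipode b1 * b3))) ->
     equivariant coact coact br).
Proof.
move=> _ _ _ Bu Bc tl brb brE.
pose rp (x : A) : {linear B -> repalg A B} := rep x.
have br_core x y b c : br (rp x b) (rp y c) =
    sw2 x (fun x1 x2 => sw2 y (fun y1 y2 => ksgn (deg x2 * (deg y1 + n)) *:
      bracket_core t (rp (rho x1 y1)) (rp x2) (rp y2) b c)).
  rewrite [LHS]brE; apply: eq_tsum => x1 x2; apply: eq_tsum => y1 y2.
  exact: (bracket_core_sw3 Bu Bc).
split=> [x y b c|coact ch cc crep].
  rewrite [LHS]br_core; apply: eq_tsum => x1 x2; apply: eq_tsum => y1 y2.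
  apply: esym; exact: (bracket_core_sw4 Bu Bc tl).
apply: (@equivariant_of_generators K A B (repalg A B) n br coact t rp rho
  (fun x2 y1 => ksgn (deg x2 * (deg y1 + n)))) => //.
move=> P P0 P1 PG Plin Pmul p u; elim=> {p u}.
- exact: P0.
- exact: P1.
- by move=> p q x b xp bq; apply: PG; [exists x, b|exact: RepHpartSym].
- by move=> p a u v up Pu vp Pv; apply: Plin.
by move=> p q u v up Pu vq Pv; apply: Pmul.
Qed.
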